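(* Let $w\in \mathrm{TGr}_0(d,n)$. Then there is a closed immersion $$\psi_w:\ \mathrm{in}_w\mathrm{Gr}_0(d,n)\hookrightarrow \varprojlim_{Q\in\Delta_w}\mathrm{Gr}_{M_Q}.$$
   Context: Let $\mathbf{k}$ be an algebraically closed field of characteristic $0$, $[n]=\{0,1,\dots,n-1\}$, and let $\binom{[n]}{d}$ be the set of $d$-element subsets of $[n]$. Thin Schubert cells. $\mathrm{Gr}(d,n)\subset\mathbb{P}(\wedge^d\mathbf{k}^n)$ is the Grassmannian of $d$-dimensional subspaces of $\mathbf{k}^n$ in its Plücker embedding, with Plücker coordinates $p_\lambda$ ($\lambda\in\binom{[n]}{d}$) and Plücker ideal $I^{d,n}\subset\mathbf{k}[p_\lambda]$. A $(d,n)$-matroid is a rank $d$ matroid on $[n]$; $\mathcal{B}(M)$ is its set of bases. Put $B_M=\mathbf{k}[p_\lambda:\lambda\in\mathcal{B}(M)]$, $I_M=(I^{d,n}+\langle p_\lambda:\lambda\notin\mathcal{B}(M)\rangle)\cap B_M$, let $T(M)$ be the dense torus of $\mathrm{Proj}(B_M)$ (where all $p_\lambda$, $\lambda\in\mathcal{B}(M)$, are nonzero), and define the thin Schubert cell $\mathrm{Gr}_M=T(M)\cap\mathrm{Proj}(B_M/I_M)$. $U(d,n)$ is the uniform matroid and $\mathrm{Gr}_0(d,n)=\mathrm{Gr}_{U(d,n)}$ is the open subscheme of $\mathrm{Gr}(d,n)$ where all Plücker coordinates are nonzero. Face maps. $e_\lambda=\sum_{i\in\lambda}e_i\in\mathbb{R}^n$;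 the matroid polytope of $M$ is $Q_M=\mathrm{conv}\{e_\beta:\beta\in\mathcal{B}(M)\}$. If $Q_{M'}$ is a face of $Q_M$, the inclusion $B_{M'}\subset B_M$ maps $I_{M'}$ into $I_M$ and induces a morphism $\varphi_{M,M'}:\mathrm{Gr}_M\to\mathrm{Gr}_{M'}$ (projection onto the Plücker coordinates indexed by $\mathcal{B}(M')$). Initial degenerations. For $w\in\mathbb{R}^{\binom{[n]}{d}}$, the initial form $\mathrm{in}_wf$ of a polynomial $f$ is the sum of its terms of minimal $w$-weight, $\mathrm{in}_wI=\langle\mathrm{in}_wf:f\in I\rangle$, and $\mathrm{in}_w\mathrm{Gr}_0(d,n)=T(U(d,n))\cap\mathrm{Proj}(\mathbf{k}[p_\lambda]/\mathrm{in}_wI^{d,n})$. $\mathrm{TGr}_0(d,n)$ is the tropicalization, i.e. the set of $w$ (in $\mathbb{R}^{\binom{[n]}{d}}/\mathbb{R}\mathbf{1}$) with $\mathrm{in}_w\mathrm{Gr}_0(d,n)\neq\emptyset$. Subdivision. $\Delta_w$ is the regular subdivision of the hypersimplex $\Delta(d,n)=Q_{U(d,n)}$ induced by $w$: its cells are the projections of the lower faces of $\mathrm{conv}\{(e_\lambda,w_\lambda)\}$. For $w\in\mathrm{TGr}_0(d,n)$ every cell $Q$ of $\Delta_w$ is a matroid polytope; $M_Q$ denotes its matroid. The limit $\varprojlim_{Q\in\Delta_w}\mathrm{Gr}_{M_Q}$ is the limit in affine $\mathbf{k}$-schemes over all cells of $\Delta_w$, with morphisms $\varphi_{M_Q,M_{Q'}}$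 whenever $Q'$ is a face of $Q$. *)

(* Defs.v *)
From HB Require Import structures.
From mathcomp Require Import all_boot all_order all_algebra.
From mathcomp Require Import boolp classical_sets reals.
From mathcomp Require Import generic_quotient mpoly ring.

Set Implicit Arguments.
Unset Strict Implicit.
Unset Printing Implicit Defensive.

Import Order.TTheory GRing.Theory Num.Theory.
Local Open Scope classical_set_scope.
Local Open Scope ring_scope.

(* The zero ring must be allowed (empty schemes), which excludes MathComp's
   comAlgType. *)

Record kalg (K : fieldType) := KAlg {
  kalg_ring :> comPzRingType;
  kalg_str : {rmorphism K -> kalg_ring} }.

Record kalg_hom (K : fieldType) (A B : kalg K) := KAlgHom {
  kalg_fun :> {rmorphism A -> B};
  kalg_fun_str : forall c, kalg_fun (kalg_str A c) = kalg_str B c }.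

(* The k-algebra obtained from a type with operations satisfying the axioms
   up to a congruence. *)
Record setoid_alg (K : fieldType) := SetoidAlg {
  sa_car : Type;
  sa_eq : sa_car -> sa_car -> Prop;
  sa_add : sa_car -> sa_car -> sa_car;
  sa_mul : sa_car -> sa_car -> sa_car;
  sa_opp : sa_car -> sa_car;
  sa_str : K -> sa_car;
  sa_refl : forall x, sa_eq x x;
  sa_sym : forall x y, sa_eq x y -> sa_eq y x;
  sa_trans : forall x y z, sa_eq x y -> sa_eq y z -> sa_eq x z;
  sa_addE : forall x x' y y', sa_eq x x' -> sa_eq y y' ->
    sa_eq (sa_add x y) (sa_add x' y');
  sa_mulE : forall x x' y y', sa_eq x x' -> sa_eq y y' ->
    sa_eq (sa_mul x y) (sa_mul x' y');
  sa_oppE : forall x x', sa_eq x x' -> sa_eq (sa_opp x) (sa_opp x');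
  sa_addA : forall x y z,
    sa_eq (sa_add x (sa_add y z)) (sa_add (sa_add x y) z);
  sa_addC : forall x y, sa_eq (sa_add x y) (sa_add y x);
  sa_add0 : forall x, sa_eq (sa_add (sa_str 0) x) x;
  sa_addN : forall x, sa_eq (sa_add (sa_opp x) x) (sa_str 0);
  sa_mulA : forall x y z,
    sa_eq (sa_mul x (sa_mul y z)) (sa_mul (sa_mul x y) z);
  sa_mulC : forall x y, sa_eq (sa_mul x y) (sa_mul y x);
  sa_mul1 : forall x, sa_eq (sa_mul (sa_str 1) x) x;
  sa_mulD : forall x y z,
    sa_eq (sa_mul (sa_add x y) z) (sa_add (sa_mul x z) (sa_mul y z));
  sa_strD : forall b c, sa_eq (sa_str (b + c)) (sa_add (sa_str b) (sa_str c));
  sa_strM : forall b c, sa_eq (sa_str (b * c)) (sa_mul (sa_str b) (sa_str c)) }.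

Section SetoidQuotient.
Variables (K : fieldType) (S : setoid_alg K).

Local Notation T := {classic (sa_car S)}.

Definition sa_rel : rel T := fun x y => `[< @sa_eq K S x y >].

Lemma sa_rel_refl : reflexive sa_rel.
Proof. by move=> x; apply/asboolP; exact: sa_refl. Qed.

Lemma sa_rel_sym : ssrbool.symmetric sa_rel.
Proof. by move=> x y; apply/asboolP/asboolP; exact: sa_sym. Qed.

Lemma sa_rel_trans : transitive sa_rel.
Proof.
by move=> y x z /asboolP xy /asboolP yz; apply/asboolP; exact: sa_trans xy yz.
Qed.

Definition sa_equiv : equiv_rel T :=
  EquivRel sa_rel sa_rel_refl sa_rel_sym sa_rel_trans.

Definition sa_quot := {eq_quot sa_equiv}%qT.
HB.instance Definition _ := Choice.on sa_quot.

Definition sa_pi (x : sa_car S) : sa_quot := (\pi_sa_quot (x : T))%qT.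
Definition sa_repr (q : sa_quot) : sa_car S := repr q.

Lemma sa_reprK q : sa_pi (sa_repr q) = q.
Proof. exact: reprK. Qed.

Lemma sa_piP x y : sa_pi x = sa_pi y <-> sa_eq x y.
Proof.
split=> [/eqquotP /asboolP //|xy].
by apply/eqquotP/asboolP.
Qed.

Lemma sa_repr_pi x : sa_eq (sa_repr (sa_pi x)) x.
Proof. by apply/sa_piP; rewrite sa_reprK. Qed.

Definition saq_str (c : K) : sa_quot := sa_pi (sa_str S c).
Definition saq_add p q := sa_pi (sa_add (sa_repr p) (sa_repr q)).
Definition saq_mul p q := sa_pi (sa_mul (sa_repr p) (sa_repr q)).
Definition saq_opp p := sa_pi (sa_opp (sa_repr p)).

Lemma saq_addE x y : saq_add (sa_pi x) (sa_pi y) = sa_pi (sa_add x y).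
Proof. by apply/sa_piP; apply: sa_addE; exact: sa_repr_pi. Qed.

Lemma saq_mulE x y : saq_mul (sa_pi x) (sa_pi y) = sa_pi (sa_mul x y).
Proof. by apply/sa_piP; apply: sa_mulE; exact: sa_repr_pi. Qed.

Lemma saq_oppE x : saq_opp (sa_pi x) = sa_pi (sa_opp x).
Proof. by apply/sa_piP; apply: sa_oppE; exact: sa_repr_pi. Qed.

Lemma sa_quotW (P : sa_quot -> Prop) : (forall x, P (sa_pi x)) -> forall q, P q.
Proof. by move=> H q; rewrite -(sa_reprK q). Qed.

Fact saq_addA : associative saq_add.
Proof.
elim/sa_quotW=> x; elim/sa_quotW=> y; elim/sa_quotW=> z.
by rewrite !saq_addE; apply/sa_piP; exact: sa_addA.
Qed.

Fact saq_addC : commutative saq_add.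
Proof.
elim/sa_quotW=> x; elim/sa_quotW=> y.
by rewrite !saq_addE; apply/sa_piP; exact: sa_addC.
Qed.

Fact saq_add0 : left_id (saq_str 0) saq_add.
Proof.
by elim/sa_quotW=> x; rewrite saq_addE; apply/sa_piP; exact: sa_add0.
Qed.

Fact saq_addN : left_inverse (saq_str 0) saq_opp saq_add.
Proof.
by elim/sa_quotW=> x; rewrite saq_oppE saq_addE; apply/sa_piP; exact: sa_addN.
Qed.

HB.instance Definition _ :=
  GRing.isZmodule.Build sa_quot saq_addA saq_addC saq_add0 saq_addN.

Fact saq_mulA : associative saq_mul.
Proof.
elim/sa_quotW=> x; elim/sa_quotW=> y; elim/sa_quotW=> z.
by rewrite !saq_mulE; apply/sa_piP; exact: sa_mulA.
Qed.

Fact saq_mulC : commutative saq_mul.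
Proof.
elim/sa_quotW=> x; elim/sa_quotW=> y.
by rewrite !saq_mulE; apply/sa_piP; exact: sa_mulC.
Qed.

Fact saq_mul1 : left_id (saq_str 1) saq_mul.
Proof.
by elim/sa_quotW=> x; rewrite saq_mulE; apply/sa_piP; exact: sa_mul1.
Qed.

Fact saq_mulD : left_distributive saq_mul saq_add.
Proof.
elim/sa_quotW=> x; elim/sa_quotW=> y; elim/sa_quotW=> z.
rewrite (saq_addE x y) (saq_mulE (sa_add x y) z) (saq_mulE x z) (saq_mulE y z).
by rewrite saq_addE; apply/sa_piP; exact: sa_mulD.
Qed.

HB.instance Definition _ :=
  GRing.Zmodule_isComPzRing.Build sa_quot saq_mulA saq_mulC saq_mul1 saq_mulD.

Lemma sa_piD x y : sa_pi (sa_add x y) = sa_pi x + sa_pi y.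
Proof. by rewrite -saq_addE. Qed.

Lemma sa_piM x y : sa_pi (sa_mul x y) = sa_pi x * sa_pi y.
Proof. by rewrite -saq_mulE. Qed.

Lemma sa_piN x : sa_pi (sa_opp x) = - sa_pi x.
Proof. by rewrite -saq_oppE. Qed.

Lemma sa_pi0 : sa_pi (sa_str S 0) = 0. Proof. by []. Qed.
Lemma sa_pi1 : sa_pi (sa_str S 1) = 1. Proof. by []. Qed.

Fact saq_str_nmod : nmod_morphism saq_str.
Proof.
by split=> // b c; rewrite -sa_piD; apply/sa_piP; exact: sa_strD.
Qed.

Fact saq_str_monoid : monoid_morphism saq_str.
Proof.
by split=> // b c; rewrite -sa_piM; apply/sa_piP; exact: sa_strM.
Qed.

HB.instance Definition _ := GRing.isNmodMorphism.Build K sa_quot saq_str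
  saq_str_nmod.
HB.instance Definition _ := GRing.isMonoidMorphism.Build K sa_quot saq_str
  saq_str_monoid.

Definition setoid_kalg : kalg K := @KAlg K sa_quot saq_str.

Variables (A : kalg K) (f : sa_car S -> A).
Hypothesis f_eq : forall x y, sa_eq x y -> f x = f y.
Hypothesis f_add : forall x y, f (sa_add x y) = f x + f y.
Hypothesis f_mul : forall x y, f (sa_mul x y) = f x * f y.
Hypothesis f_str : forall c, f (sa_str S c) = kalg_str A c.

Definition saq_lift_fun (q : sa_quot) : A := f (sa_repr q).

Lemma saq_lift_pi x : saq_lift_fun (sa_pi x) = f x.
Proof. exact: f_eq (sa_repr_pi x). Qed.

Fact saq_lift_nmod : nmod_morphism saq_lift_fun.
Proof.
split; first by rewrite -sa_pi0 saq_lift_pi f_str rmorph0.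
elim/sa_quotW=> x; elim/sa_quotW=> y.
by rewrite -sa_piD !saq_lift_pi f_add.
Qed.

Fact saq_lift_monoid : monoid_morphism saq_lift_fun.
Proof.
split; first by rewrite -sa_pi1 saq_lift_pi f_str rmorph1.
elim/sa_quotW=> x; elim/sa_quotW=> y.
by rewrite -sa_piM !saq_lift_pi f_mul.
Qed.

HB.instance Definition _ := GRing.isNmodMorphism.Build sa_quot A saq_lift_fun
  saq_lift_nmod.
HB.instance Definition _ := GRing.isMonoidMorphism.Build sa_quot A saq_lift_fun
  saq_lift_monoid.

Fact saq_lift_str c : saq_lift_fun (kalg_str setoid_kalg c) = kalg_str A c.
Proof. by rewrite saq_lift_pi f_str. Qed.

Definition saq_lift : kalg_hom setoid_kalg A :=
  @KAlgHom K setoid_kalg A saq_lift_fun saq_lift_str.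

End SetoidQuotient.

(* Affine k-schemes, as the opposite category of commutative k-algebras. *)

Record affine_scheme (K : fieldType) := Spec { coord_ring : kalg K }.

Definition morphism (K : fieldType) (X Y : affine_scheme K) :=
  kalg_hom (coord_ring Y) (coord_ring X).

(* Closed immersions of affine schemes are the surjections of coordinate
   rings. *)
Definition closed_immersion (K : fieldType) (X Y : affine_scheme K)
    (f : morphism X Y) : Prop :=
  forall b : coord_ring X, exists a : coord_ring Y, f a = b.

Definition nonempty_scheme (K : fieldType) (X : affine_scheme K) : Prop :=
  (1 : coord_ring X) <> 0.

Record diagram (K : fieldType) := Diagram {
  dg_obj : Type;
  dg_arr : dg_obj -> dg_obj -> Type;
  dg_scheme : dg_obj -> affine_scheme K;
  dg_mor : forall i j, dg_arr i j -> morphism (dg_scheme i) (dg_scheme j) }.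

(* The limit of a diagram of affine schemes is the spectrum of the colimit of
   the coordinate rings, i.e. of the k-algebra with a generator for every
   element of every ring of the diagram, and the relations saying that the
   rings map to it homomorphically and compatibly with the arrows.  The
   universal property is limit_cone and limit_universal below. *)
Section Limit.
Variables (K : fieldType) (D : diagram K).

Local Notation A j := (coord_ring (dg_scheme (d := D) j)).

Inductive lim_term :=
| LGen (j : dg_obj D) (a : A j)
| LStr (c : K)
| LAdd (x y : lim_term)
| LMul (x y : lim_term)
| LOpp (x : lim_term).

Inductive lim_eq : lim_term -> lim_term -> Prop :=
| LRefl x : lim_eq x x
| LSym x y : lim_eq x y -> lim_eq y x
| LTrans x y z : lim_eq x y -> lim_eq y z -> lim_eq x z
| LAddE x x' y y' : lim_eq x x' -> lim_eq y y' ->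
    lim_eq (LAdd x y) (LAdd x' y')
| LMulE x x' y y' : lim_eq x x' -> lim_eq y y' ->
    lim_eq (LMul x y) (LMul x' y')
| LOppE x x' : lim_eq x x' -> lim_eq (LOpp x) (LOpp x')
| LAddA x y z : lim_eq (LAdd x (LAdd y z)) (LAdd (LAdd x y) z)
| LAddC x y : lim_eq (LAdd x y) (LAdd y x)
| LAdd0 x : lim_eq (LAdd (LStr 0) x) x
| LAddN x : lim_eq (LAdd (LOpp x) x) (LStr 0)
| LMulA x y z : lim_eq (LMul x (LMul y z)) (LMul (LMul x y) z)
| LMulC x y : lim_eq (LMul x y) (LMul y x)
| LMul1 x : lim_eq (LMul (LStr 1) x) x
| LMulD x y z : lim_eq (LMul (LAdd x y) z) (LAdd (LMul x z) (LMul y z))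
| LStrD b c : lim_eq (LStr (b + c)) (LAdd (LStr b) (LStr c))
| LStrM b c : lim_eq (LStr (b * c)) (LMul (LStr b) (LStr c))
| LGenD j (a b : A j) : lim_eq (LGen (a + b)) (LAdd (LGen a) (LGen b))
| LGenM j (a b : A j) : lim_eq (LGen (a * b)) (LMul (LGen a) (LGen b))
| LGenS j c : lim_eq (LGen (kalg_str (A j) c)) (LStr c)
| LGenArr i j (u : dg_arr i j) (a : A j) : lim_eq (LGen a) (LGen (dg_mor u a)).

Definition lim_setoid : setoid_alg K :=
  SetoidAlg LRefl LSym LTrans LAddE LMulE LOppE LAddA LAddC LAdd0 LAddN
    LMulA LMulC LMul1 LMulD LStrD LStrM.

Definition limit : affine_scheme K := Spec (setoid_kalg lim_setoid).

Definition lim_gen j (a : A j) : coord_ring limit :=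
  @sa_pi K lim_setoid (LGen a).

Fact lim_gen_nmod j : nmod_morphism (@lim_gen j).
Proof.
split=> [|a b]; last by rewrite -sa_piD; apply/sa_piP; exact: LGenD.
rewrite -(rmorph0 (kalg_str (A j))); apply/sa_piP; exact: LGenS.
Qed.

Fact lim_gen_monoid j : monoid_morphism (@lim_gen j).
Proof.
split=> [|a b]; last by rewrite -sa_piM; apply/sa_piP; exact: LGenM.
rewrite -(rmorph1 (kalg_str (A j))); apply/sa_piP; exact: LGenS.
Qed.

HB.instance Definition _ j := GRing.isNmodMorphism.Build
  (A j) (coord_ring limit) (@lim_gen j) (@lim_gen_nmod j).
HB.instance Definition _ j := GRing.isMonoidMorphism.Build
  (A j) (coord_ring limit) (@lim_gen j) (@lim_gen_monoid j).

Fact lim_gen_str j c : lim_gen (kalg_str (A j) c) = kalg_str (coord_ring limit) c.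
Proof. by apply/sa_piP; exact: LGenS. Qed.

Definition limit_proj j : morphism limit (dg_scheme j) :=
  @KAlgHom K (A j) (coord_ring limit) (@lim_gen j) (@lim_gen_str j).

Lemma limit_cone i j (u : dg_arr i j) (a : A j) :
  limit_proj j a = limit_proj i (dg_mor u a).
Proof. by apply/sa_piP; exact: LGenArr. Qed.

Lemma limit_universal (Y : affine_scheme K)
    (p : forall j, morphism Y (dg_scheme j))
    (p_cone : forall i j (u : dg_arr i j) (a : A j), p j a = p i (dg_mor u a)) :
  exists f : morphism Y limit,
    (forall j a, f (limit_proj j a) = p j a) /\
    (forall g : morphism Y limit,
       (forall j a, g (limit_proj j a) = p j a) -> g =1 f).
Proof.
pose B := coord_ring Y.
pose ev := fix ev (x : lim_term) : B := match x with
  | LGen j a => p j a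
  | LStr c => kalg_str B c
  | LAdd x y => ev x + ev y
  | LMul x y => ev x * ev y
  | LOpp x => - ev x end.
have ev_eq x y : lim_eq x y -> ev x = ev y.
  elim=> //= *; first [congruence | by rewrite addrA | by rewrite addrC
    | by rewrite rmorph0 add0r | by rewrite addNr rmorph0 | by rewrite mulrA
    | by rewrite mulrC | by rewrite rmorph1 mul1r | by rewrite mulrDl
    | by rewrite rmorphD | by rewrite rmorphM | by rewrite kalg_fun_str].
pose f : morphism Y limit := @saq_lift K lim_setoid B ev ev_eq
  (fun _ _ => erefl) (fun _ _ => erefl) (fun _ => erefl).
have fE x : f (@sa_pi K lim_setoid x) = ev x by exact: saq_lift_pi.
exists f; split=> [j a|g gp]; first by rewrite fE.
elim/sa_quotW=> x; rewrite fE; elim: x => [j a|c|x IHx y IHy|x IHx y IHy|x IHx] /=.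
- exact: gp.
- exact: (kalg_fun_str g c).
- by rewrite -IHx -IHy -rmorphD -sa_piD.
- by rewrite -IHx -IHy -rmorphM -sa_piM.
- by rewrite -IHx -rmorphN -sa_piN.
Qed.

End Limit.

(* Polynomials with variables p_i indexed by a finite type I. *)

Section Polynomials.
Variables (K : fieldType) (I : finType).

Local Notation P := {mpoly K[#|I|]}.
Implicit Types (B : {set I}) (a b f g : P) (m : 'X_{1..#|I|}).

Definition mvar (i : I) : P := 'X_(enum_rank i).

Definition mexp (m : 'X_{1..#|I|}) (i : I) : nat := m (enum_rank i).

Definition poly_on (B : {set I}) (f : P) : bool :=
  all (fun m => [forall i, (i \in B) || (mexp m i == 0%N)]) (msupp f).

Lemma poly_onP B f : reflect
  (forall m, m \in msupp f -> forall i, i \notin B -> mexp m i = 0%N)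
  (poly_on B f).
Proof.
apply: (iffP allP) => H m mf.
  by move=> i iB; have /forallP/(_ i) := H m mf; rewrite (negPf iB) => /eqP.
by apply/forallP => i; case: (boolP (i \in B)) => //= iB; rewrite H.
Qed.

Lemma mexpD m m' i : mexp (m + m') i = (mexp m i + mexp m' i)%N.
Proof. by rewrite /mexp mnmDE. Qed.

Lemma mexpU i j : mexp U_(enum_rank i) j = (i == j)%N.
Proof. by rewrite /mexp mnm1E (inj_eq enum_rank_inj). Qed.

Lemma poly_onC B c : poly_on B c%:MP.
Proof.
apply/poly_onP => m; rewrite msuppC; case: ifP => // _.
by rewrite inE => /eqP -> i _; rewrite /mexp mnm0E.
Qed.

Lemma poly_on0 B : poly_on B 0.
Proof. by rewrite -mpolyC0; exact: poly_onC. Qed.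

Lemma poly_on1 B : poly_on B 1.
Proof. by rewrite -mpolyC1; exact: poly_onC. Qed.

Lemma poly_onD B f g : poly_on B f -> poly_on B g -> poly_on B (f + g).
Proof.
move=> /poly_onP Hf /poly_onP Hg; apply/poly_onP => m.
by move/msuppD_le; rewrite mem_cat => /orP[/Hf|/Hg].
Qed.

Lemma poly_onN B f : poly_on B f -> poly_on B (- f).
Proof.
move=> /poly_onP Hf; apply/poly_onP => m.
by rewrite (perm_mem (msuppN f)) => /Hf.
Qed.

Lemma poly_onM B f g : poly_on B f -> poly_on B g -> poly_on B (f * g).
Proof.
move=> /poly_onP Hf /poly_onP Hg; apply/poly_onP => m.
move/msuppM_le/allpairsP => [[m1 m2] /= [/Hf H1 /Hg H2 ->]] i iB.
by rewrite mexpD H1 // H2.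
Qed.

Lemma poly_onX B f n : poly_on B f -> poly_on B (f ^+ n).
Proof.
move=> Hf; elim: n => [|n IHn]; first by rewrite expr0 poly_on1.
by rewrite exprS poly_onM.
Qed.

Lemma poly_on_var B i : i \in B -> poly_on B (mvar i).
Proof.
move=> iB; apply/poly_onP => m; rewrite msuppX inE => /eqP -> j jB.
by rewrite mexpU; case: eqP => // ij; rewrite -ij iB in jB.
Qed.

Lemma poly_on_setT f : poly_on [set: I]%SET f.
Proof. by apply/poly_onP => m _ i; rewrite inE. Qed.

Lemma poly_onS B B' f : B \subset B' -> poly_on B f -> poly_on B' f.
Proof.
move=> /fintype.subsetP sB /poly_onP Hf; apply/poly_onP => m mf i iB.
by apply: Hf => //; apply: contra iB; exact: sB.
Qed.

Definition mvars (B : {set I}) : P := \prod_(i in B) mvar i.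

Lemma poly_on_vars B : poly_on B (mvars B).
Proof.
rewrite /mvars; elim/big_ind: _ => [|f g|i]; first exact: poly_on1.
  exact: poly_onM.
exact: poly_on_var.
Qed.

Lemma mvars_homog B : mvars B \is #|B|.-homog.
Proof.
rewrite /mvars -sum1_card; elim/big_rec2: _ => [|i n f _ Hf].
  exact: dhomog1.
by apply: dhomogM => //; rewrite dhomogX; apply/eqP; exact: mdeg1.
Qed.

Record ideal_on (B : {set I}) := IdealOn {
  ideal_set : set P;
  ideal_on_poly : forall a, ideal_set a -> poly_on B a;
  ideal_on0 : ideal_set 0;
  ideal_onD : forall a b, ideal_set a -> ideal_set b -> ideal_set (a + b);
  ideal_onM : forall a b, poly_on B a -> ideal_set b -> ideal_set (a * b) }.

(* The ideal of the whole polynomial ring generated by S. *)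
Definition ideal_gen (S : set P) : set P :=
  [set f | exists2 s : seq (P * P),
     forall x, x \in s -> S x.2 & f = \sum_(x <- s) x.1 * x.2].

Lemma ideal_gen0 S : ideal_gen S 0.
Proof. by exists [::] => //; rewrite big_nil. Qed.

Lemma ideal_genD S a b : ideal_gen S a -> ideal_gen S b -> ideal_gen S (a + b).
Proof.
move=> [s Hs ->] [t Ht ->]; exists (s ++ t); last by rewrite big_cat.
by move=> x; rewrite mem_cat => /orP[/Hs|/Ht].
Qed.

Lemma ideal_genM S a b : ideal_gen S b -> ideal_gen S (a * b).
Proof.
move=> [s Hs ->]; exists [seq (a * x.1, x.2) | x <- s].
  by move=> _ /mapP[x /Hs Hx ->].
by rewrite big_map mulr_sumr; apply: eq_bigr => x _; rewrite mulrA.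
Qed.

(* The affine scheme Spec (S_(f)) for S = k[p_i : i in B] / J and f the
   product of the p_i, i in B; that is, the intersection of Proj S with the
   locus where no p_i vanishes.  The degree zero part S_(f) of the localization
   S_f consists of the fractions num / f^den with num homogeneous of degree
   den * deg f. *)
Section TorusProj.
Variables (B : {set I}) (J : ideal_on B).

Record fraction := Fraction {
  num : P;
  den : nat;
  num_on : poly_on B num;
  num_homog : num \is (den * #|B|).-homog }.

Definition frac_eq (x y : fraction) : Prop := exists s,
  ideal_set J (mvars B ^+ s * (mvars B ^+ den y * num x - mvars B ^+ den x * num y)).

Lemma mvarsX_homog n : mvars B ^+ n \is (n * #|B|).-homog.
Proof. by rewrite mulnC; apply: dhomogMn; exact: mvars_homog. Qed.

Lemma num_add_on x y :
  poly_on B (num x * mvars B ^+ den y + num y * mvars B ^+ den x).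
Proof.
by rewrite poly_onD ?poly_onM ?num_on ?poly_onX ?poly_on_vars.
Qed.

Lemma num_add_homog x y : num x * mvars B ^+ den y + num y * mvars B ^+ den x
  \is ((den x + den y) * #|B|).-homog.
Proof.
by rewrite dhomogD // mulnDl; [|rewrite addnC];
  apply: dhomogM; rewrite ?num_homog ?mvarsX_homog.
Qed.

Definition frac_add x y := Fraction (num_add_on x y) (num_add_homog x y).

Lemma num_mul_homog x y : num x * num y \is ((den x + den y) * #|B|).-homog.
Proof. by rewrite mulnDl; apply: dhomogM; rewrite num_homog. Qed.

Definition frac_mul x y :=
  Fraction (poly_onM (num_on x) (num_on y)) (num_mul_homog x y).

Lemma num_opp_homog x : - num x \is (den x * #|B|).-homog.
Proof. by rewrite dhomogN num_homog. Qed.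

Definition frac_opp x := Fraction (poly_onN (num_on x)) (num_opp_homog x).

Lemma num_str_homog (c : K) : (c%:MP : P) \is (0 * #|B|).-homog.
Proof. by rewrite mul0n -(mulr1 c%:MP) mul_mpolyC dhomogZ // dhomog1. Qed.

Definition frac_str (c : K) := Fraction (poly_onC B c) (num_str_homog c).

Lemma ideal_onB a b : ideal_set J a -> ideal_set J b -> ideal_set J (a - b).
Proof.
move=> Ja Jb; apply: ideal_onD => //; rewrite -mulN1r.
by apply: ideal_onM => //; rewrite poly_onN ?poly_on1.
Qed.

Lemma frac_eq0 x y :
  mvars B ^+ den y * num x = mvars B ^+ den x * num y -> frac_eq x y.
Proof. by move=> e; exists 0%N; rewrite e subrr mulr0; exact: ideal_on0. Qed.

Lemma frac_sym x y : frac_eq x y -> frac_eq y x.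
Proof.
move=> [s Hs]; exists s; rewrite -opprB mulrN -mulN1r.
by apply: ideal_onM => //; rewrite poly_onN ?poly_on1.
Qed.

Lemma frac_trans x y z : frac_eq x y -> frac_eq y z -> frac_eq x z.
Proof.
move=> [s Hs] [t Ht]; exists (s + t + den y)%N.
have fP n : poly_on B (mvars B ^+ n) by rewrite poly_onX ?poly_on_vars.
have := ideal_onD
  (ideal_onM (poly_onM (fP t) (fP (den z))) Hs)
  (ideal_onM (poly_onM (fP s) (fP (den x))) Ht).
by congr (ideal_set J _); rewrite !exprD; ring.
Qed.

Lemma frac_addE x x' y y' : frac_eq x x' -> frac_eq y y' ->
  frac_eq (frac_add x y) (frac_add x' y').
Proof.
move=> [s Hs] [t Ht]; exists (s + t)%N => /=.
have fP n : poly_on B (mvars B ^+ n) by rewrite poly_onX ?poly_on_vars.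
have := ideal_onD
  (ideal_onM (poly_onM (fP t) (poly_onM (fP (den y)) (fP (den y')))) Hs)
  (ideal_onM (poly_onM (fP s) (poly_onM (fP (den x)) (fP (den x')))) Ht).
by congr (ideal_set J _); rewrite !exprD; ring.
Qed.

Lemma frac_mulE x x' y y' : frac_eq x x' -> frac_eq y y' ->
  frac_eq (frac_mul x y) (frac_mul x' y').
Proof.
move=> [s Hs] [t Ht]; exists (s + t)%N => /=.
have fP n : poly_on B (mvars B ^+ n) by rewrite poly_onX ?poly_on_vars.
have := ideal_onD
  (ideal_onM (poly_onM (fP t) (poly_onM (fP (den y')) (num_on y))) Hs)
  (ideal_onM (poly_onM (fP s) (poly_onM (fP (den x)) (num_on x'))) Ht).
by congr (ideal_set J _); rewrite !exprD; ring.
Qed.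

Lemma frac_oppE x x' : frac_eq x x' -> frac_eq (frac_opp x) (frac_opp x').
Proof.
move=> [s Hs]; exists s => /=.
have := ideal_onM (poly_onN (poly_on1 B)) Hs.
by congr (ideal_set J _); ring.
Qed.

Ltac frac_tac :=
  move=> *; apply: frac_eq0; rewrite /= ?exprD ?expr0 ?mpolyC0 ?mpolyC1
    ?mpolyCD ?mpolyCM; ring.

Definition frac_setoid : setoid_alg K.
Proof.
refine (@SetoidAlg K fraction frac_eq frac_add frac_mul frac_opp frac_str
  _ frac_sym frac_trans frac_addE frac_mulE frac_oppE
  _ _ _ _ _ _ _ _ _ _); by frac_tac.
Defined.

Definition torus_proj : affine_scheme K := Spec (setoid_kalg frac_setoid).

End TorusProj.

(* For B' included in B and J' in J, the inclusion of k[p_i : i in B'] in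
   k[p_i : i in B] induces the morphism num / f'^den |-> num r^den / f^den,
   where f = f' r. *)
Section TorusProjMap.
Variables (B B' : {set I}) (J : ideal_on B) (J' : ideal_on B').
Hypothesis sB : B' \subset B.
Hypothesis sJ : ideal_set J' `<=` ideal_set J.

Lemma mvarsS : mvars B = mvars B' * mvars (B :\: B').
Proof.
rewrite /mvars (big_setID B') /=; congr (_ * _).
by rewrite (finset.setIidPr sB).
Qed.

Lemma num_map_on (x : fraction B') :
  poly_on B (num x * mvars (B :\: B') ^+ den x).
Proof.
rewrite poly_onM ?(poly_onS sB (num_on x)) // poly_onX //.
by apply: poly_onS (poly_on_vars _); exact: finset.subsetDl.
Qed.

Lemma num_map_homog (x : fraction B') :
  num x * mvars (B :\: B') ^+ den x \is (den x * #|B|).-homog.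
Proof.
rewrite -(cardsID B' B) (finset.setIidPr sB) mulnDr.
by apply: dhomogM; rewrite ?num_homog ?mvarsX_homog.
Qed.

Definition frac_map (x : fraction B') : fraction B :=
  Fraction (num_map_on x) (num_map_homog x).

Definition torus_proj_fun (x : fraction B') : coord_ring (torus_proj J) :=
  @sa_pi K (frac_setoid J) (frac_map x).

Lemma torus_proj_eq x y : frac_eq J' x y -> torus_proj_fun x = torus_proj_fun y.
Proof.
move=> [s Hs]; apply/sa_piP; exists s => /=.
have rP : poly_on B (mvars (B :\: B') ^+ (s + den x + den y)).
  by rewrite poly_onX // (poly_onS (finset.subsetDl _ _) (poly_on_vars _)).
have := ideal_onM rP (sJ Hs); congr (ideal_set J _).
by rewrite mvarsS !exprMn !exprD; ring.
Qed.

Lemma torus_projD x y :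
  torus_proj_fun (frac_add x y) = torus_proj_fun x + torus_proj_fun y.
Proof.
rewrite -sa_piD; apply/sa_piP/frac_eq0 => /=.
by rewrite mvarsS !exprMn !exprD; ring.
Qed.

Lemma torus_projM x y :
  torus_proj_fun (frac_mul x y) = torus_proj_fun x * torus_proj_fun y.
Proof.
rewrite -sa_piM; apply/sa_piP/frac_eq0 => /=.
by rewrite mvarsS !exprMn !exprD; ring.
Qed.

Lemma torus_proj_str c :
  torus_proj_fun (frac_str B' c) = kalg_str (coord_ring (torus_proj J)) c.
Proof. by apply/sa_piP/frac_eq0 => /=; rewrite !expr0; ring. Qed.

Definition torus_proj_map : morphism (torus_proj J) (torus_proj J') :=
  @saq_lift K (frac_setoid J') (coord_ring (torus_proj J)) torus_proj_fun
    torus_proj_eq torus_projD torus_projM torus_proj_str.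

End TorusProjMap.

End Polynomials.

Section Polytopes.
Variables (R : realType) (N : nat).

Definition conv (I : finType) (B : {set I}) (v : I -> 'rV[R]_N) :
    set 'rV[R]_N :=
  [set x | exists c : I -> R, [/\ forall i, 0 <= c i, \sum_(i in B) c i = 1
     & x = \sum_(i in B) c i *: v i]].

Definition pairing (x : 'rV[R]_N) (u : 'cV[R]_N) : R := (x *m u) 0 0.

Definition exposed_by (u : 'cV[R]_N) (F Q : set 'rV[R]_N) : Prop :=
  F !=set0 /\ exists c, (forall x, Q x -> c <= pairing x u) /\
    F = Q `&` [set x | pairing x u = c].

(* Faces are nonempty, and Q is a face of itself (u = 0). *)
Definition is_face (F Q : set 'rV[R]_N) : Prop := exists u, exposed_by u F Q.

End Polytopes.

Definition subset_of (d n : nat) := {lambda : {set 'I_n} | #|lambda| == d}.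
HB.instance Definition _ d n := Finite.on (subset_of d n).

Section Matroids.
Variables (d n : nat).
Local Notation index := (subset_of d n).

Record matroid := Matroid {
  bases : {set index};
  bases_neq0 : bases != finset.set0;
  bases_exchange : forall X Y : index, X \in bases -> Y \in bases ->
    forall x, x \in val X :\: val Y ->
    exists2 y, y \in val Y :\: val X &
    exists2 Z, Z \in bases & val Z = y |: (val X :\ x) }.

Variable R : realType.

Definition indicator (lambda : index) : 'rV[R]_n :=
  \row_i (i \in val lambda)%:R.

Definition matroid_polytope (M : matroid) : set 'rV[R]_n :=
  conv (bases M) indicator.

Variable w : index -> R.

Definition lifted_vertex (lambda : index) : 'rV[R]_(n + 1) :=
  row_mx (indicator lambda) (w lambda)%:M.

Definition lifted_polytope : set 'rV[R]_(n + 1) :=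
  conv [set: index]%SET lifted_vertex.

Definition is_lower_face (F : set 'rV[R]_(n + 1)) : Prop :=
  exists2 u : 'cV[R]_(n + 1), 0 < u (rshift n 0) 0 &
    exposed_by u F lifted_polytope.

Definition subdivision : set (set 'rV[R]_n) :=
  [set Q | exists2 F, is_lower_face F & Q = lsubmx @` F].

(* Cells Q are indexed by their matroid M_Q: for w in TGr_0(d, n) every cell
   is the polytope of exactly one matroid. *)
Definition cell : Type :=
  {M : matroid | subdivision (matroid_polytope M)}.

Lemma indicator_conv (B : {set index}) (lambda : index) :
  conv B indicator (indicator lambda) -> lambda \in B.
Proof.
move=> [c [c_ge0 c_sum /rowP e]]; apply/negPn/negP => lB.
pose s (mu : index) := \sum_(i in val lambda) (i \in val mu)%:R : R.
have sE mu : s mu = #|val lambda :&: val mu|%:R.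
  rewrite /s -natr_sum -sum1_card big_mkcond [in RHS]big_mkcond /=.
  by congr (_%:R); apply: eq_bigr => i _; rewrite finset.in_setI; do 2!case: (_ \in _).
have e' : s lambda = \sum_(mu in B) c mu * s mu.
  rewrite /s; under [RHS]eq_bigr => mu _ do rewrite mulr_sumr.
  rewrite exchange_big; apply: eq_bigr => i _.
  have := e i; rewrite mxE => ->; rewrite summxE.
  by apply: eq_bigr => mu _; rewrite !mxE.
have sl : s lambda = d%:R by rewrite sE finset.setIid (eqP (valP lambda)).
have slt mu : mu \in B -> s mu <= d%:R - 1.
  move=> muB; rewrite lerBrDr sE natr1 ler_nat.
  rewrite -[ltnRHS](eqP (valP lambda)); apply: proper_card.
  rewrite finset.properEneq finset.subsetIl andbT; apply/eqP => /finset.setIidPl sub.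
  have /eqP : val lambda == val mu.
    by rewrite eqEcard sub (eqP (valP lambda)) (eqP (valP mu)) leqnn.
  by move/val_inj => E; rewrite E muB in lB.
have : s lambda <= \sum_(mu in B) c mu * (d%:R - 1).
  by rewrite e'; apply: ler_sum => mu muB; rewrite ler_wpM2l ?slt.
rewrite -mulr_suml c_sum mul1r sl -subr_ge0 addrAC subrr add0r.
by rewrite oppr_ge0 ler10.
Qed.

End Matroids.

Arguments matroid_polytope {d n} R M _.

Section Cells.
Variable K : closedFieldType.
Variables d n : nat.
Local Notation index := (subset_of d n).
Local Notation P := {mpoly K[#|{: index}|]}.

(* enum_val lists the elements of lambda in increasing order. *)
Definition minor (A : 'M[K]_(d, n)) (lambda : index) : K :=
  \det (colsub (fun i : 'I_d =>
    enum_val (cast_ord (esym (eqP (valP lambda))) i)) A).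

Definition peval (v : index -> K) (f : P) : K := f.@[fun k => v (enum_val k)].

(* The homogeneous ideal of Gr(d, n), i.e. the polynomials vanishing on its
   affine cone.  The scalar c matters only when d = 0, where the minors of A
   alone do not sweep out the cone. *)
Definition plucker_ideal : set P :=
  [set f | forall (A : 'M[K]_(d, n)) (c : K), row_free A ->
     peval (fun lambda => c * minor A lambda) f = 0].

(* Homogeneity of the Pluecker ideal with respect to the gradings coming from
   the torus action; it is what makes the face maps well defined. *)

Implicit Types (phi : pred 'X_{1..#|{: index}|}) (f g : P).
Implicit Types (m : 'X_{1..#|{: index}|}).

Definition mfilter (phi : pred 'X_{1..#|{: index}|}) (f : P) : P :=
  \sum_(m <- msupp f | phi m) f@_m *: 'X_[m].

Lemma mfilter_coeff phi f m : (mfilter phi f)@_m = if phi m then f@_m else 0.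
Proof.
rewrite /mfilter raddf_sum /=.
under eq_bigr => m' _ do rewrite mcoeffZ mcoeffX.
have [mf|mf] := boolP (m \in msupp f); last first.
  rewrite memN_msupp_eq0 // if_same big_seq_cond big1 // => m' /andP[m'f _].
  by case: eqP => [E|_]; [rewrite -E m'f in mf|rewrite mulr0].
rewrite big_mkcond (bigD1_seq m) ?msupp_uniq //= eqxx mulr1 big1 ?addr0 //.
by move=> m' /negPf ->; rewrite mulr0 if_same.
Qed.

Lemma mfilter_supp phi f m : (m \in msupp (mfilter phi f)) = phi m && (m \in msupp f).
Proof. by rewrite !mcoeff_msupp mfilter_coeff; case: (phi m); rewrite ?eqxx. Qed.

Lemma mfilterD phi f g : mfilter phi (f + g) = mfilter phi f + mfilter phi g.
Proof.
apply/mpolyP => m; rewrite mcoeffD !mfilter_coeff mcoeffD.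
by case: (phi m); rewrite ?addr0.
Qed.

Lemma mfilter_id phi f : (forall m, m \in msupp f -> phi m) -> mfilter phi f = f.
Proof.
move=> H; apply/mpolyP => m; rewrite mfilter_coeff.
have [/H -> //|mf] := boolP (m \in msupp f).
by rewrite (memN_msupp_eq0 mf) if_same.
Qed.

Lemma mfilter_closed (V : set P) (s : seq ('X_{1..#|{: index}|} -> nat)) :
    V 0 -> (forall f g, V f -> V g -> V (f + g)) ->
    (forall e, List.In e s -> forall j f, V f -> V (mfilter (fun m => e m == j) f)) ->
  forall phi f, V f ->
    (forall m m', m \in msupp f -> m' \in msupp f ->
      (forall e, List.In e s -> e m = e m') -> phi m = phi m') ->
  V (mfilter phi f).
Proof.
move=> V0 VD; elim: s => [|g s IHs] Vs phi f Vf phiP.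
  case E : (msupp f) => [|m0 r].
    suff -> : mfilter phi f = 0 by [].
    by rewrite /mfilter E big_nil.
  have m0f : m0 \in msupp f by rewrite E inE eqxx.
  case p0 : (phi m0).
    by rewrite mfilter_id // => m mf; rewrite (phiP _ _ mf m0f).
  suff -> : mfilter phi f = 0 by [].
  rewrite /mfilter big_seq_cond big1 // => m /andP[mf].
  by rewrite (phiP _ _ mf m0f) // p0.
pose N := (\max_(m <- msupp f) g m).+1.
have -> : mfilter phi f =
    \sum_(j < N) mfilter phi (mfilter (fun m => g m == j) f).
  apply/mpolyP => m; rewrite mfilter_coeff raddf_sum /=.
  under eq_bigr => j _ do rewrite !mfilter_coeff.
  have [mf|mf] := boolP (m \in msupp f); last first.
    rewrite memN_msupp_eq0 // if_same big1 // => j _.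
    by rewrite !if_same.
  have gN : (g m < N)%N by rewrite ltnS; apply: leq_bigmax_seq.
  rewrite (bigD1 (Ordinal gN)) //= eqxx big1 ?addr0 // => j jm.
  case: ifP => // _; case: ifP => // /eqP gj.
  by case/eqP: jm; apply: val_inj; rewrite /= gj.
have Vsum (F : 'I_N -> P) : (forall j, V (F j)) -> V (\sum_j F j).
  by move=> VF; elim/big_ind: _.
apply: Vsum => j; apply: IHs.
- by move=> h hs; apply: Vs; right.
- by apply: Vs => //; left.
move=> m m'; rewrite !mfilter_supp => /andP[/eqP gm mf] /andP[/eqP gm' m'f] H.
by apply: phiP => // h [<-|]; [rewrite gm gm'|exact: H].
Qed.

Lemma peval_eq v v' f : v =1 v' -> peval v f = peval v' f.
Proof. by move=> e; apply: meval_eq => k; rewrite e. Qed.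

Lemma poly_eq0_off0 (p : {poly K}) : (forall t, t != 0 -> p.[t] = 0) -> p = 0.
Proof.
move=> H; apply/eqP; apply: contraT => p0.
have : size ('X * p + 1) != 1%N.
  rewrite size_polyDl ?size_Xmul ?size_poly1 // mulrC size_mulX // ?ltnS ?eqSS ?size_poly_gt0 ?size_poly_eq0 //.
move/closed_rootP => [t /rootP]; rewrite !hornerE.
have [->|t0] := eqVneq t 0.
  by rewrite mul0r add0r => /eqP; rewrite oner_eq0.
by rewrite H // mulr0 add0r => /eqP; rewrite oner_eq0.
Qed.

Definition mgrade (e : index -> nat) (m : 'X_{1..#|{: index}|}) : nat :=
  (\sum_l e l * mexp m l)%N.

Lemma plucker_graded (e : index -> nat) :
  (forall A c t, row_free A -> t != 0 -> exists A' c', row_free A' /\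
    forall l, t ^+ e l * (c * minor A l) = c' * minor A' l) ->
  forall j f, plucker_ideal f ->
    plucker_ideal (mfilter (fun m => mgrade e m == j) f).
Proof.
move=> scale j f If A c Af.
set v := fun l => c * minor A l.
pose term m := \prod_k (v (enum_val k)) ^+ m k.
pose q : {poly K} := \sum_(m <- msupp f) (f@_m * term m) *: 'X^(mgrade e m).
have q0 : q = 0.
  apply: poly_eq0_off0 => t t0.
  have [A' [c' [A'f vE]]] := scale A c t Af t0.
  rewrite -[RHS](If A' c' A'f) -(peval_eq _ vE) /peval mevalE /q horner_sum.
  apply: eq_bigr => m _; rewrite !hornerE -mulrA; congr (_ * _).
  have -> : mgrade e m = (\sum_k e (enum_val k) * m k)%N.
    rewrite /mgrade (reindex _ (onW_bij _ (@enum_val_bij index))).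
    by apply: eq_bigr => k _; rewrite /mexp enum_valK.
  rewrite /term expr_sum -big_split /=; apply: eq_bigr => k _.
  by rewrite [RHS]exprMn exprM [LHS]mulrC.
have := congr1 (fun p : {poly K} => p`_j) q0; rewrite coef0 => <-.
rewrite /peval /mfilter raddf_sum /q coef_sum big_mkcond /=.
apply: eq_bigr => m _; rewrite coefZ coefXn eq_sym.
case: eqP => _; last by rewrite mulr0.
by rewrite mulr1 mevalZ mevalX.
Qed.

Lemma minor_scale (A : 'M[K]_(d, n)) (D : 'rV[K]_n) (l : index) :
  minor (A *m diag_mx D) l = minor A l * \prod_(i in val l) D 0 i.
Proof.
rewrite /minor; set s := fun i => enum_val _.
have -> : colsub s (A *m diag_mx D) = colsub s A *m diag_mx (colsub s D).
  by apply/matrixP => i j; rewrite !mul_mx_diag !mxE.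
rewrite det_mulmx det_diag; congr (_ * _).
under eq_bigr => i _ do rewrite mxE.
rewrite [RHS]big_enum_val /=.
rewrite (reindex _ (onW_bij _ (Bijective (cast_ordK (esym (eqP (valP l)))) (cast_ordKV _)))) /=.
by apply: eq_bigr.
Qed.

Lemma plucker_graded_col (i : 'I_n) j f : plucker_ideal f ->
  plucker_ideal (mfilter (fun m => mgrade (fun l => i \in val l) m == j) f).
Proof.
apply: plucker_graded => A c t Af t0.
pose D : 'rV[K]_n := \row_k (if k == i then t else 1).
exists (A *m diag_mx D), c; split.
  rewrite /row_free mxrankMfree // row_free_unit unitmxE det_diag unitfE.
  by apply/prodf_neq0 => k _; rewrite mxE; case: ifP => //; rewrite oner_eq0.
move=> l; rewrite minor_scale mulrCA; congr (_ * _); rewrite mulrC; congr (_ * _).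
under eq_bigr => k _ do rewrite mxE.
rewrite -big_mkcondr /=; case: (boolP (i \in val l)) => il.
  rewrite (big_pred1 i) // => k; rewrite andbC /=.
  by case: eqP => // ->.
rewrite big_pred0 // => k; rewrite andbC; case: eqP => // -> /=.
exact: negPf.
Qed.

Lemma plucker_graded_deg j f : plucker_ideal f ->
  plucker_ideal (mfilter (fun m => mgrade (fun=> 1%N) m == j) f).
Proof.
apply: plucker_graded => A c t Af t0; exists A, (t * c).
by split=> // l; rewrite expr1 mulrA.
Qed.

Definition mweight (R : realType) (w : index -> R)
    (m : 'X_{1..#|{: index}|}) : R := \sum_l w l *+ mexp m l.

Lemma plucker_weight (R : realType) (u : 'cV[R]_n) (c : R) f :
  plucker_ideal f ->
  plucker_ideal
    (mfilter (fun m => mweight (fun l => pairing (indicator R l) u - c) m == 0) f).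
Proof.
move=> If.
pose s := (fun m => mgrade (fun=> 1%N) m) ::
  [seq (fun m => mgrade (fun l : index => i \in val l) m) | i <- enum 'I_n].
apply: (@mfilter_closed _ s) => //.
- by move=> A b _; rewrite /peval raddf0.
- move=> g h Ig Ih A b Af; rewrite /peval raddfD /=.
  by have := Ig A b Af; have := Ih A b Af; rewrite /peval => -> ->; rewrite addr0.
- move=> e [<-|es] j g; first exact: plucker_graded_deg.
  elim: (enum 'I_n) es => //= i r IHr [<-|/IHr //].
  exact: plucker_graded_col.
move=> m m' _ _ H; congr (_ == 0).
have wE m1 : mweight (fun l => pairing (indicator R l) u - c) m1 =
    \sum_i u i 0 *+ mgrade (fun l : index => i \in val l) m1
    - c *+ mgrade (fun=> 1%N) m1.
  rewrite /mweight /mgrade /=.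
  under eq_bigr => l _ do rewrite mulrnBl.
  rewrite sumrB; congr (_ - _); last first.
    by rewrite -sumrMnr; apply: eq_bigr => l _; rewrite mul1n.
  under [RHS]eq_bigr => i _ do rewrite -sumrMnr.
  rewrite exchange_big /=; apply: eq_bigr => l _.
  rewrite /pairing mxE -sumrMnl; apply: eq_bigr => i _.
  by rewrite mxE mulr_natl mulrnA.
rewrite !wE; congr (_ - _ *+ _); last by apply: H; left.
apply: eq_bigr => i _; congr (_ *+ _); apply: H; right.
have : i \in enum 'I_n by rewrite mem_enum.
elim: (enum 'I_n) => //= k r IHr; rewrite inE => /orP[/eqP ->|/IHr]; first by left.
by right.
Qed.

Definition vanishing_ideal (B : {set index}) : set P :=
  ideal_gen [set mvar K lambda | lambda in [set l | l \notin B]].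

Lemma vanishing_idealP (B : {set index}) f : vanishing_ideal B f <->
  forall m, m \in msupp f -> exists2 l, l \notin B & mexp m l != 0%N.
Proof.
split=> [[s Hs ->] m|H].
  move/msupp_sum_le => /flatten_mapP[x]; rewrite mem_filter /= => xs.
  have [l /= lB <-] := Hs x xs.
  move/msuppM_le/allpairsP => [[m1 m2] /= [_ Hm2 ->]].
  exists l => //; move: Hm2; rewrite msuppX inE => /eqP ->.
  by rewrite mexpD mexpU eqxx addn1.
rewrite (mpolyE f) big_seq.
apply: (big_ind (vanishing_ideal B)) => [|a b|m mf]; first exact: ideal_gen0.
  exact: ideal_genD.
have [l lB lm] := H m mf; exists [:: (f@_m *: 'X_[m - U_(enum_rank l)], mvar K l)].
  by move=> x; rewrite inE => /eqP -> /=; exists l.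
rewrite big_seq1 /= -scalerAl /mvar -mpolyXD submK //.
apply/mnm_lepP => k; rewrite mnm1E; case: eqP => // <-.
by rewrite lt0n.
Qed.

Definition thin_ideal_set (M : matroid d n) : set P :=
  [set f | poly_on (bases M) f /\ exists g h,
     [/\ plucker_ideal g, vanishing_ideal (bases M) h & f = g + h]].

Lemma plucker_ideal0 : plucker_ideal 0.
Proof. by move=> A c _; rewrite /peval raddf0. Qed.

Lemma plucker_idealD f g :
  plucker_ideal f -> plucker_ideal g -> plucker_ideal (f + g).
Proof.
move=> If Ig A c Af; have := If A c Af; have := Ig A c Af.
by rewrite /peval raddfD /= => -> ->; rewrite addr0.
Qed.

Lemma plucker_idealM f g : plucker_ideal g -> plucker_ideal (f * g).
Proof.
move=> Ig A c Af; have := Ig A c Af.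
by rewrite /peval mevalM => ->; rewrite mulr0.
Qed.

Section ThinCell.
Variable M : matroid d n.

Fact thin_ideal0 : thin_ideal_set M 0.
Proof.
split; first exact: poly_on0.
exists 0, 0; split; last by rewrite addr0.
  exact: plucker_ideal0.
exact: ideal_gen0.
Qed.

Fact thin_idealD a b :
  thin_ideal_set M a -> thin_ideal_set M b -> thin_ideal_set M (a + b).
Proof.
move=> [aB [g [h [Ig Ih ea]]]] [bB [g' [h' [Ig' Ih' eb]]]].
split; first exact: poly_onD.
exists (g + g'), (h + h'); split; last by rewrite ea eb addrACA.
  exact: plucker_idealD.
exact: ideal_genD.
Qed.

Fact thin_idealM a b :
  poly_on (bases M) a -> thin_ideal_set M b -> thin_ideal_set M (a * b).
Proof.
move=> aB [bB [g [h [Ig Ih eb]]]]; split; first exact: poly_onM.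
exists (a * g), (a * h); split; last by rewrite eb mulrDr.
  exact: plucker_idealM.
exact: ideal_genM.
Qed.

Definition thin_ideal : ideal_on K (bases M) :=
  @IdealOn K index (bases M) (thin_ideal_set M) (fun a => @proj1 _ _)
    thin_ideal0 thin_idealD thin_idealM.

Definition thin_cell : affine_scheme K := torus_proj thin_ideal.

End ThinCell.

Section FaceMap.
Variables (R : realType) (M M' : matroid d n).
Hypothesis face : is_face (matroid_polytope R M') (matroid_polytope R M).

Lemma vertex_polytope (N : matroid d n) l :
  l \in bases N -> matroid_polytope R N (indicator R l).
Proof.
move=> lN; exists (fun k => (k == l)%:R); split=> [k||].
- exact: ler0n.
- rewrite (bigD1 l) //= eqxx big1 ?addr0 // => k /andP[_ /negPf ->] //.
- rewrite (bigD1 l) //= eqxx scale1r big1 ?addr0 // => k /andP[_ /negPf ->].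
  by rewrite scale0r.
Qed.

Lemma face_bases : bases M' \subset bases M.
Proof.
case: face => u [_ [c [_ E]]]; apply/fintype.subsetP => l lM'.
by apply: (@indicator_conv _ _ R); have := vertex_polytope lM'; rewrite E => -[].
Qed.

Lemma face_ideal : thin_ideal_set M' `<=` thin_ideal_set M.
Proof.
have sB := face_bases; move=> f [fM' [g [h [Ig Ih fE]]]].
split; first exact: poly_onS fM'.
case: face => u [_ [c [cmin E]]].
pose wt (l : index) := pairing (indicator R l) u - c.
have wt0 l : l \in bases M' -> wt l = 0.
  move=> lM'; have := vertex_polytope lM'; rewrite E => -[_ /= lc].
  by rewrite /wt lc subrr.
have wt_ge0 l : l \in bases M -> 0 <= wt l.
  by move=> lM; rewrite subr_ge0 cmin //; exact: vertex_polytope.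
have wt_gt0 l : l \in bases M -> l \notin bases M' -> 0 < wt l.
  move=> lM lM'; rewrite lt_def wt_ge0 // andbT; apply: contra lM'.
  rewrite subr_eq0 => /eqP lc; apply: (@indicator_conv _ _ R).
  change (matroid_polytope R M' (indicator R l)).
  by rewrite E; split => //; exact: vertex_polytope.
pose phi m := mweight wt m == 0.
have fphi : mfilter phi f = f.
  apply: mfilter_id => m mf; apply/eqP/big1 => l _.
  case: (boolP (l \in bases M')) => lM'; first by rewrite wt0 // mul0rn.
  by rewrite (poly_onP _ _ fM' m mf l lM') mulr0n.
exists (mfilter phi g), (mfilter phi h); split.
- exact: plucker_weight.
- apply/vanishing_idealP => m; rewrite mfilter_supp => /andP[/eqP m0 mh].
  have [l lM' lm] := (vanishing_idealP _ _).1 Ih m mh.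
  apply/exists2P; apply: contrapT => /forallNP N.
  have mM k : k \notin bases M -> mexp m k = 0%N.
    by move=> kM; apply/eqP/negPn/negP => km; apply: (N k).
  have lM : l \in bases M.
    by apply/negPn/negP => /mM lm0; rewrite lm0 in lm.
  have : 0 < mweight wt m.
    rewrite /mweight (bigD1 l) //= ltr_wpDr //; last first.
      by rewrite pmulrn_lgt0 ?lt0n // wt_gt0.
    apply: sumr_ge0 => k _; case: (boolP (k \in bases M)) => kM.
      by rewrite mulrn_wge0 // wt_ge0.
    by rewrite mM.
  by rewrite m0 ltxx.
- by rewrite -mfilterD -fE fphi.
Qed.

Definition face_map : morphism (thin_cell M) (thin_cell M') :=
  @torus_proj_map K index (bases M) (bases M') (thin_ideal M) (thin_ideal M')
    face_bases face_ideal.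

End FaceMap.

Section InitialDegeneration.
Variables (R : realType) (w : index -> R).

Definition initial_form (f : P) : P :=
  mfilter (fun m => all (fun m' => mweight w m <= mweight w m') (msupp f)) f.

Definition initial_ideal_set : set P :=
  ideal_gen [set initial_form f | f in plucker_ideal].

Definition initial_ideal : ideal_on K [set: index]%SET :=
  @IdealOn K index [set: index]%SET initial_ideal_set
    (fun a _ => poly_on_setT a) (@ideal_gen0 _ _ _) (@ideal_genD _ _ _)
    (fun a b _ => @ideal_genM _ _ _ a b).

Definition initial_degeneration : affine_scheme K := torus_proj initial_ideal.

(* w lies in TGr_0(d, n); this only depends on w modulo constant functions, as
   the Pluecker ideal is homogeneous. *)
Definition in_tropical_grassmannian : Prop :=
  nonempty_scheme initial_degeneration.

Definition cell_diagram : diagram K :=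
  @Diagram K (cell w)
    (fun Q Q' => is_face (matroid_polytope R (sval Q'))
                         (matroid_polytope R (sval Q)))
    (fun Q => thin_cell (sval Q))
    (fun Q Q' QQ' => face_map QQ').

End InitialDegeneration.

End Cells.

(* Main.v *)
From mathcomp Require Import mpoly ring lra zify.
Require Import Defs.
From HB Require Import structures.
From mathcomp Require Import all_boot all_order all_algebra.
From mathcomp Require Import boolp classical_sets reals.

(** Write A for the coordinate ring of the initial degeneration: the degree
    zero part of the localization of k[p]/in_w I at the product of all the
    variables.  It is generated by the ratios p_l / p_m.

    The morphism.  A cell of the subdivision with matroid M is cut out by an
    affine function wt(l) = u.e_l + t w_l - c with t > 0 that is nonnegative on
    all d-subsets and vanishes exactly on the bases of M.  If f = g + h lies in
    I_M, with g in the Pluecker ideal and h in the ideal of the variables off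
    the bases, then every monomial of h has positive wt-weight while f has
    weight 0, so f is the part of g of weight 0, the lowest possible one.
    Splitting g into components for the grading by the torus (k^star)^n times
    scalars, under which the Pluecker ideal is stable, the wt-weight and the
    w-weight differ on each component by a constant and a factor t > 0; hence
    each component of f is 0 or the initial form of one of g.  So I_M is
    contained in in_w I (cell_thin_ideal), and the inclusion of variables
    induces a map from the initial degeneration to the thin Schubert cell of M.
    These maps commute with the face maps and factor through the limit.

    The closed immersion.  Surjectivity on coordinate rings only needs the
    edges of the hypersimplex.  If m = l - x + y, then [e_l, e_m] is an edge of
    the hypersimplex containing no other e_k, so it is a cell of every regular
    subdivision (edge_cell), and its matroid has the two bases l and m.  The
    coordinate ring of its thin cell contains p_l / p_m (edge_ratio).  As any
    two d-subsets are joined by a chain of such exchanges, all the ratios lie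
    in the image (johnson_ratio), and they generate A (ratios_generate). *)

Set Implicit Arguments.
Unset Strict Implicit.
Unset Printing Implicit Defensive.

Import Order.TTheory GRing.Theory Num.Theory.
Local Open Scope classical_set_scope.
Local Open Scope ring_scope.

(** * Cells of the regular subdivision as zero sets of affine functions *)

Section SubdivisionCells.
Variables (R : realType) (d n : nat) (w : subset_of d n -> R).
Local Notation index := (subset_of d n).
Implicit Types (B : {set index}) (l m : index).

Lemma pairing_sumZ (N : nat) (I : finType) (B : {set I}) (a : I -> R)
    (v : I -> 'rV[R]_N) (u : 'cV[R]_N) :
  pairing (\sum_(i in B) a i *: v i) u = \sum_(i in B) a i * pairing (v i) u.
Proof.
rewrite /pairing mulmx_suml summxE; apply: eq_bigr => i _.
by rewrite -scalemxAl mxE.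
Qed.

Lemma lsub_lifted (a : index -> R) B :
  lsubmx (\sum_(l in B) a l *: lifted_vertex w l) =
  \sum_(l in B) a l *: indicator R l.
Proof.
rewrite linear_sum; apply: eq_bigr => l _.
by rewrite linearZ /= row_mxKl.
Qed.

Lemma conv_vertex (N : nat) (I : finType) (B : {set I}) (v : I -> 'rV[R]_N) i :
  i \in B -> conv B v (v i).
Proof.
move=> iB; exists (fun k => (k == i)%:R); split=> [k||].
- exact: ler0n.
- by rewrite (bigD1 i) //= eqxx big1 ?addr0 // => k /andP[_ /negPf ->].
- rewrite (bigD1 i) //= eqxx scale1r big1 ?addr0 // => k /andP[_ /negPf ->].
  by rewrite scale0r.
Qed.

(** The points e_l are vertices of the hypersimplex: were a l < 1, dividing the
    remaining coefficients by 1 - a l would write e_l as a convex combination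
    of the other indicators, against indicator_conv. *)
Lemma indicator_extreme (a : index -> R) l :
    (forall k, 0 <= a k) -> \sum_(k in [set: index]%SET) a k = 1 ->
    indicator R l = \sum_(k in [set: index]%SET) a k *: indicator R k ->
  forall k, a k = (k == l)%:R.
Proof.
move=> a_ge0 a_sum e.
pose B := finset.setC [set l]%SET.
have restE (V : nmodType) (F : index -> V) :
    \sum_(k in [set: index]%SET) F k = F l + \sum_(k in B) F k.
  rewrite (bigD1 l) ?inE //=; congr (_ + _); apply: eq_bigl => k.
  by rewrite !inE.
have sB : \sum_(k in B) a k = 1 - a l by rewrite -a_sum restE addrAC subrr add0r.
have al : a l = 1.
  apply/eqP/negPn/negP => al.
  have nz : 1 - a l != 0 by rewrite subr_eq0 eq_sym.
  suff : l \in B by rewrite !inE eqxx.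
  apply: (@indicator_conv _ _ R); exists (fun k => a k / (1 - a l)); split.
  - move=> k; rewrite divr_ge0 // -sB; exact: sumr_ge0.
  - by rewrite -mulr_suml sB divff.
  - apply: (scalerI nz); rewrite scaler_sumr.
    rewrite scalerBl scale1r [X in X - _]e restE addrAC subrr add0r.
    by apply: eq_bigr => k _; rewrite scalerA mulrC divfK.
move=> k; case: eqP => [->//|/eqP kl] /=.
move: sB; rewrite al subrr => /eqP.
rewrite psumr_eq0 // => /allP/(_ k); rewrite mem_index_enum !inE kl.
by move=> /(_ isT)/eqP.
Qed.

(** The linear functional exposing a lower face, restricted to the lifted
    vertices.  A vertex e_l of the cell is the projection of some point of the
    face; since e_l is extreme, that point can only be the lift of e_l itself,
    so the functional attains its minimum there. *)
Lemma cell_height B :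
    subdivision w (conv B (indicator R)) ->
  exists (u : 'cV[R]_n) (t c : R), 0 < t /\
    forall l, let h := pairing (indicator R l) u + t * w l in
      c <= h /\ (h == c) = (l \in B).
Proof.
move=> [F [u ut [_ [c [cmin FE]]]] BE].
exists (usubmx u), (u (rshift n 0) 0), c; split=> // l.
have -> : pairing (indicator R l) (usubmx u) + u (rshift n 0) 0 * w l =
    pairing (lifted_vertex w l) u.
  rewrite /pairing /lifted_vertex -[in RHS](vsubmxK u) mul_row_col [RHS]mxE.
  by congr (_ + _); rewrite mul_scalar_mx !mxE mulrC.
have lP : lifted_polytope w (lifted_vertex w l) by apply: conv_vertex; rewrite inE.
split; first exact: cmin.
apply/eqP/idP => [lc|lB].
  apply: (@indicator_conv _ _ R); rewrite BE; exists (lifted_vertex w l).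
    by rewrite FE.
  by rewrite row_mxKl.
have : conv B (indicator R) (indicator R l) by exact: conv_vertex.
rewrite BE => -[x Fx xl]; move: Fx; rewrite FE => -[[a [a0 a1 xE]] /= <-].
have aE k : a k = (k == l)%:R.
  by apply: (indicator_extreme a0 a1); rewrite -xl xE lsub_lifted.
rewrite xE pairing_sumZ (bigD1 l) ?inE //= aE eqxx mul1r big1 ?addr0 //.
by move=> k /andP[_ kl]; rewrite aE (negPf kl) mul0r.
Qed.

(** Partial converse of cell_height, with the last coordinate of the functional
    normalized to 1. *)
Lemma height_cell B (u : 'cV[R]_n) (c : R) :
    B != finset.set0 ->
    (forall l, let h := pairing (indicator R l) u + w l in
      c <= h /\ (h == c) = (l \in B)) ->
  subdivision w (conv B (indicator R)).
Proof.
move=> /finset.set0Pn[l0 l0B] H.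
pose U : 'cV[R]_(n + 1) := col_mx u 1%:M.
have UE l : pairing (lifted_vertex w l) U = pairing (indicator R l) u + w l.
  rewrite /pairing /lifted_vertex mul_row_col mxE; congr (_ + _).
  by rewrite mulmx1 mxE.
have geU l : c <= pairing (lifted_vertex w l) U by rewrite UE; case: (H l).
have eqU l : (pairing (lifted_vertex w l) U == c) = (l \in B).
  by rewrite UE; case: (H l).
exists (lifted_polytope w `&` [set x | pairing x U = c]).
  exists U; first by rewrite /U col_mxEd mxE.
  split.
    exists (lifted_vertex w l0); split; first by apply: conv_vertex; rewrite inE.
    by apply/eqP; rewrite eqU.
  exists c; split=> // x [a [a0 a1 ->]]; rewrite pairing_sumZ.
  rewrite -[c]mul1r -a1 mulr_suml; apply: ler_sum => k _.
  exact: ler_wpM2l.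
apply/seteqP; split=> x.
  move=> [a [a0 a1 xE]].
  pose b k := if k \in B then a k else 0.
  have sE (V : nmodType) (F : index -> V) :
      \sum_(k in [set: index]%SET) (if k \in B then F k else 0) = \sum_(k in B) F k.
    by rewrite -big_mkcondr; apply: eq_bigl => k; rewrite inE.
  exists (\sum_(k in [set: index]%SET) b k *: lifted_vertex w k); last first.
    rewrite lsub_lifted xE -sE; apply: eq_bigr => k _.
    by rewrite /b; case: ifP; rewrite ?scale0r.
  split.
    exists b; split=> //; first by move=> k; rewrite /b; case: ifP.
    by rewrite sE.
  rewrite /= pairing_sumZ -[RHS]mul1r -a1 mulr_suml -sE; apply: eq_bigr => k _.
  rewrite /b -eqU; case: eqP => [->//|_]; exact: mul0r.
move=> [_ [[a [a0 a1 ->]] /=]]; rewrite pairing_sumZ lsub_lifted => ac <-.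
(* The gap between the functional and c averages to 0 and is nonnegative. *)
have az k : k \notin B -> a k = 0.
  move=> kB; have : \sum_(k in [set: index]%SET) a k * (pairing (lifted_vertex w k) U - c) = 0.
    under eq_bigr => j _ do rewrite mulrBr.
    by rewrite sumrB ac -mulr_suml a1 mul1r subrr.
  move/eqP; rewrite psumr_eq0 => [|j _]; last by rewrite mulr_ge0 // subr_ge0.
  move/allP/(_ k); rewrite mem_index_enum inE /= => /(_ isT).
  by rewrite mulf_eq0 subr_eq0 eqU (negPf kB) orbF => /eqP.
have sE (V : nmodType) (F : index -> V) : (forall k, k \notin B -> F k = 0) ->
    \sum_(k in [set: index]%SET) F k = \sum_(k in B) F k.
  move=> F0; rewrite [RHS]big_mkcond /=; apply: eq_big => [k|k _]; first by rewrite inE.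
  by case: ifP => // /negbT /F0.
exists a; split=> //; first by rewrite -sE.
by apply: sE => k /az ->; rewrite scale0r.
Qed.

End SubdivisionCells.

(** * Edges of the hypersimplex *)

Section EdgeMatroid.
Variables (d n : nat).
Local Notation index := (subset_of d n).
Variables (l m : index) (x y : 'I_n).
Hypotheses (xl : x \in val l) (yl : y \notin val l).
Hypothesis mE : val m = y |: (val l :\ x).

Let xy : x != y. Proof. by apply: contraNneq yl => <-. Qed.

Let lE : val l = x |: (val m :\ y).
Proof.
apply/setP => z; rewrite mE !inE; case: (eqVneq z x) => [->|zx] //=.
by case: (eqVneq z y) => [->|zy] //=; rewrite (negPf yl).
Qed.

Let xm : x \notin val m.
Proof. by rewrite mE !inE negb_or xy eqxx. Qed.

Lemma edge_exchange (X Y : index) : X \in [set l; m]%SET -> Y \in [set l; m]%SET ->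
  forall z, z \in val X :\: val Y ->
    exists2 t, t \in val Y :\: val X &
    exists2 Z, Z \in [set l; m]%SET & val Z = t |: (val X :\ z).
Proof.
rewrite !inE => /orP[]/eqP -> /orP[]/eqP -> z; rewrite ?finset.setDv ?inE //.
- move=> /andP[zm zl]; have -> : z = x.
    by apply/eqP; move: zm; rewrite mE !inE zl andbT negb_or negbK => /andP[].
  exists y; first by rewrite mE !inE eqxx yl.
  by exists m => //; rewrite !inE eqxx orbT.
- move=> /andP[zl zm]; have -> : z = y.
    by apply/eqP; move: zm; rewrite mE !inE (negPf zl) andbF orbF.
  exists x; first by rewrite !inE xl xm.
  by exists l => //; rewrite !inE eqxx.
Qed.

Lemma edge_neq0 : [set l; m]%SET != finset.set0.
Proof. by apply/finset.set0Pn; exists l; rewrite !inE eqxx. Qed.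

Definition edge_matroid : matroid d n := Matroid edge_neq0 edge_exchange.

Variables (R : realType) (w : index -> R).

(** The functional |k meet l| + |k meet m| is maximal, equal to 2d - 1, exactly
    when k is l or m.  A large negative multiple -N of it dominates the heights
    w, and the multiple a of the coordinate at x (in l, not in m) makes the
    heights of l and m equal. *)
Lemma edge_cell : subdivision w (matroid_polytope R edge_matroid).
Proof.
pose inter (k k' : index) : nat := #|val k :&: val k'|.
have inter_le k k' : (inter k k' <= d)%N.
  by rewrite -[leqRHS](eqP (valP k)) subset_leq_card // finset.subsetIl.
have inter_lt k k' : k != k' -> (inter k k' < d)%N.
  rewrite ltn_neqAle inter_le andbT; apply: contra => /eqP e.
  apply/eqP/val_inj/eqP; rewrite eqEcard (eqP (valP k)) (eqP (valP k')) leqnn andbT.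
  apply/finset.setIidPl/eqP; rewrite eqEcard finset.subsetIl.
  by rewrite (eqP (valP k)) -[leqLHS]e leqnn.
have interC k k' : inter k k' = inter k' k by rewrite /inter finset.setIC.
have inter_id k : inter k k = d by rewrite /inter finset.setIid (eqP (valP k)).
have d1 : d = (inter l m).+1.
  rewrite /inter -[LHS](eqP (valP l)) (cardsD1 x) xl add1n; congr _.+1.
  apply: eq_card => z; rewrite mE !inE.
  case: (eqVneq z y) => [->|_] /=; first by rewrite (negPf yl) andbF.
  by rewrite andbCA andbb.
have lm : l != m by apply: contraNneq xm => <-.
pose a := w m - w l.
pose N := 1 + `|a| + \sum_k `|w m - w k|.
pose u : 'cV[R]_n := \col_i
  (a * (i == x)%:R - N * ((i \in val l)%:R + (i \in val m)%:R)).
have cnt (k k' : index) : pairing (indicator R k) (\col_i (i \in val k')%:R) = (inter k k')%:R.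
  rewrite /pairing mxE /inter -sum1_card natr_sum [RHS]big_mkcond /=.
  by apply: eq_bigr => i _; rewrite !mxE !inE; do 2!case: (_ \in _); rewrite ?mulr1 ?mulr0 ?mul0r.
have hE k : pairing (indicator R k) u =
    a * (x \in val k)%:R - N * ((inter k l)%:R + (inter k m)%:R).
  have -> : u = a *: (\col_i (i == x)%:R) -
      N *: (\col_i (i \in val l)%:R + \col_i (i \in val m)%:R).
    by apply/colP => i; rewrite !mxE.
  rewrite -!cnt /pairing mulmxBr -!scalemxAr mulmxDr !mxE; congr (_ * _ - _).
  rewrite (bigD1 x) //= big1 ?addr0 => [|i ix]; first by rewrite !mxE eqxx mulr1.
  by rewrite !mxE (negPf ix) mulr0.
apply: (@height_cell _ _ _ _ _ u (w m - N * (d%:R + (inter l m)%:R))).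
  exact: edge_neq0.
move=> k h; rewrite /h hE.
have [->|kl] := eqVneq k l.
  rewrite inter_id xl mulr1.
  have -> : a - N * (d%:R + (inter l m)%:R) + w l = w m - N * (d%:R + (inter l m)%:R).
    by rewrite /a; ring.
  by rewrite lexx eqxx !inE eqxx.
have [->|km] := eqVneq k m.
  rewrite inter_id (interC m l) (negPf xm) mulr0.
  have -> : 0 - N * ((inter l m)%:R + d%:R) + w m = w m - N * (d%:R + (inter l m)%:R) by ring.
  by rewrite lexx eqxx !inE eqxx orbT.
rewrite !inE (negPf kl) (negPf km).
suff lt : w m - N * (d%:R + (inter l m)%:R) <
    a * (x \in val k)%:R - N * ((inter k l)%:R + (inter k m)%:R) + w k.
  by rewrite (ltW lt) gt_eqF.
have N0 : 0 <= N by rewrite !addr_ge0 // sumr_ge0.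
have le1 : (inter k l)%:R + (inter k m)%:R + 1 <= d%:R + (inter l m)%:R :> R.
  rewrite -!natrD natr1 ler_nat.
  by have := inter_lt _ _ kl; have := inter_lt _ _ km; lia.
have := ler_wpM2l N0 le1; rewrite mulrDr mulr1.
have : `|w m - w k| <= \sum_k `|w m - w k|.
  by rewrite (bigD1 k) //= lerDl sumr_ge0.
have : - `|a| <= a * (x \in val k)%:R.
  case: (_ \in _); rewrite ?mulr1 ?mulr0 ?oppr_le0 ?normr_ge0 //.
  by rewrite lerNl -normrN ler_norm.
have := ler_norm (w m - w k).
rewrite {2}/N; lra.
Qed.

End EdgeMatroid.

(** * Functoriality of the torus part of Proj *)

Lemma torus_proj_mapE (K : fieldType) (I : finType) (B B' : {set I})
    (J : ideal_on K B) (J' : ideal_on K B') (sB : B' \subset B)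
    (sJ : ideal_set J' `<=` ideal_set J) (x : fraction K B') :
  torus_proj_map sB sJ (@sa_pi K (frac_setoid J') x) =
  @sa_pi K (frac_setoid J) (frac_map sB x).
Proof. exact: (@saq_lift_pi K (frac_setoid J') _ _ (torus_proj_eq sB sJ) x). Qed.

Lemma torus_proj_map_comp (K : fieldType) (I : finType) (B B' B'' : {set I})
    (J : ideal_on K B) (J' : ideal_on K B') (J'' : ideal_on K B'')
    (sB : B' \subset B) (sB' : B'' \subset B') (sB'' : B'' \subset B)
    (sJ : ideal_set J' `<=` ideal_set J)
    (sJ' : ideal_set J'' `<=` ideal_set J')
    (sJ'' : ideal_set J'' `<=` ideal_set J) (a : coord_ring (torus_proj J'')) :
  torus_proj_map sB'' sJ'' a = torus_proj_map sB sJ (torus_proj_map sB' sJ' a).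
Proof.
elim/sa_quotW: a => x; rewrite !torus_proj_mapE; apply/sa_piP/frac_eq0 => /=.
suff -> : mvars K (B :\: B'') = mvars K (B' :\: B'') * mvars K (B :\: B').
  by rewrite exprMn; ring.
rewrite {1}/mvars (big_setID B') /=; congr (_ * _); rewrite /mvars.
  apply: eq_bigl => i; rewrite !inE; case: (i \in B'') => //=.
  by case: (boolP (i \in B')) => [/(fintype.subsetP sB) ->|]; rewrite ?andbF.
apply: eq_bigl => i; rewrite !inE; case: (boolP (i \in B'')) => //=.
by move=> /(fintype.subsetP sB') ->.
Qed.

(** * From the initial degeneration to the thin Schubert cells *)

Section Degeneration.
Variables (K : closedFieldType) (R : realType) (d n : nat).
Variable w : subset_of d n -> R.
Local Notation index := (subset_of d n).
Local Notation P := {mpoly K[#|{: index}|]}.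
Implicit Types (f g : P) (m : 'X_{1..#|{: index}|}) (M : matroid d n).

(** Apart from t times the w-weight, the weight of a monomial only depends on
    its degree under the torus, which is why passing from w to the functional
    exposing a cell leaves the initial forms of torus-homogeneous polynomials
    unchanged. *)
Lemma mweight_linear (u : 'cV[R]_n) (c t : R) m :
  mweight (fun l => pairing (indicator R l) u + t * w l - c) m =
  \sum_i u i 0 *+ mgrade (fun l : index => i \in val l) m
  - c *+ mgrade (fun=> 1%N) m + t * mweight w m.
Proof.
rewrite /mweight /mgrade mulr_sumr /=.
under eq_bigr => l _ do rewrite mulrnBl mulrnDl addrAC.
rewrite big_split sumrB /=; congr (_ - _ + _).
- under [RHS]eq_bigr => i _ do rewrite -sumrMnr.
  rewrite exchange_big /=; apply: eq_bigr => l _.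
  rewrite /pairing mxE -sumrMnl; apply: eq_bigr => i _.
  by rewrite mxE mulr_natl mulrnA.
- by rewrite -sumrMnr; apply: eq_bigr => l _; rewrite mul1n.
- by apply: eq_bigr => l _; rewrite mulrnAr.
Qed.

Definition torus_degree m : {ffun 'I_n -> nat} * nat :=
  ([ffun i => mgrade (fun l : index => i \in val l) m], mgrade (fun=> 1%N) m).

(** The torus (k^star)^n scales the columns of a matrix, hence its minors, so
    the Pluecker ideal contains all the multihomogeneous components of its
    elements. *)
Lemma plucker_torus_degree t f : plucker_ideal f ->
  plucker_ideal (mfilter (fun m => torus_degree m == t) f).
Proof.
move=> If.
pose s := (fun m => mgrade (fun=> 1%N) m) ::
  [seq (fun m => mgrade (fun l : index => i \in val l) m) | i <- enum 'I_n].
apply: (@mfilter_closed K d n _ s) => //.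
- exact: plucker_ideal0.
- exact: plucker_idealD.
- move=> e /= [<- j g|]; first exact: plucker_graded_deg.
  move=> /List.in_map_iff[i [<- _]] j g; exact: plucker_graded_col.
move=> m m' _ _ H; congr (_ == t); congr (_, _); last by apply: H; left.
apply/ffunP => i; rewrite !ffunE; apply: (H (fun m => mgrade _ m)); right.
apply/List.in_map_iff; exists i; split=> //.
have : i \in enum 'I_n by rewrite mem_enum.
by elim: (enum 'I_n) => //= k r IHr; rewrite inE => /orP[/eqP ->|/IHr]; [left|right].
Qed.

Lemma mfilter_sum (T : eqType) (e : 'X_{1..#|{: index}|} -> T) f :
  f = \sum_(v <- undup (map e (msupp f))) mfilter (fun m => e m == v) f.
Proof.
apply/mpolyP => m; rewrite raddf_sum /=.
under eq_bigr => v _ do rewrite mfilter_coeff.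
have [mf|mf] := boolP (m \in msupp f); last first.
  by rewrite memN_msupp_eq0 // big1 // => v _; rewrite if_same.
rewrite (bigD1_seq (e m)) ?undup_uniq ?mem_undup ?map_f //= eqxx big1 ?addr0 //.
by move=> v /negPf; rewrite eq_sym => ->.
Qed.

(** The key inclusion: an element f = g + h of the ideal of the thin cell is the
    lowest part of g for the functional exposing the cell, and lowest parts can
    be taken one torus degree at a time, where they are initial forms for w. *)
Lemma cell_thin_ideal M : subdivision w (matroid_polytope R M) ->
  ideal_set (thin_ideal K M) `<=` ideal_set (initial_ideal K w).
Proof.
move=> /cell_height[u [t [c [t0 H]]]] f [fM [g [h [Ig Ih fE]]]].
pose wt (l : index) := pairing (indicator R l) u + t * w l - c.
have wt_ge0 l : 0 <= wt l by rewrite subr_ge0; case: (H l).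
have wt_eq0 l : (wt l == 0) = (l \in bases M) by rewrite subr_eq0; case: (H l).
have mwt_ge0 m : 0 <= mweight wt m by apply: sumr_ge0 => l _; rewrite mulrn_wge0.
have mwt_gt0 m l : l \notin bases M -> mexp m l != 0%N -> 0 < mweight wt m.
  move=> lM lm; rewrite /mweight (bigD1 l) //= ltr_wpDr //.
    by apply: sumr_ge0 => k _; rewrite mulrn_wge0.
  by rewrite pmulrn_lgt0 ?lt0n // lt_def wt_eq0 lM wt_ge0.
pose flat m := mweight wt m == 0.
have fg : mfilter flat g = f.
  have -> : g = f + - h by rewrite fE addrK.
  rewrite mfilterD [X in X + _]mfilter_id ?[X in _ + X](_ : _ = 0) ?addr0 //.
    apply/mpolyP => m; rewrite mfilter_coeff mcoeffN mcoeff0.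
    case: ifP => // /eqP m0; apply/eqP; rewrite oppr_eq0.
    apply: contraTT isT; rewrite -mcoeff_msupp => /((vanishing_idealP _ _).1 Ih).
    by case=> l lM lm; have := mwt_gt0 _ _ lM lm; rewrite m0 ltxx.
  move=> m mf; apply/eqP/big1 => l _.
  case: (boolP (l \in bases M)) => lM; first by rewrite (eqP (etrans (wt_eq0 l) lM)) mul0rn.
  by rewrite (poly_onP _ _ fM m mf l lM) mulr0n.
have wtE m m' : torus_degree m = torus_degree m' ->
    (mweight wt m <= mweight wt m') = (mweight w m <= mweight w m').
  rewrite !mweight_linear => -[/ffunP e ->].
  under eq_bigr => i _ do have /[!ffunE]-> := e i.
  by rewrite lerD2l ler_pM2l.
(* f itself need not be torus-homogeneous, so it is a sum of initial forms and
   not a single one. *)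
rewrite (mfilter_sum torus_degree f).
apply: (big_ind (@initial_ideal_set K d n R w)) => [|a b|v _].
- exact: ideal_gen0.
- exact: ideal_genD.
set fv := mfilter _ f; pose gv := mfilter (fun m => torus_degree m == v) g.
have fvE : fv = mfilter flat gv.
  apply/mpolyP => m; rewrite /fv -fg !mfilter_coeff.
  by case: (flat m); case: (_ == v).
have [->|/eqP] := EM (fv = 0); first exact: ideal_gen0.
rewrite -msupp_eq0 => fv0.
have [m0 m0fv] : exists m0, m0 \in msupp fv.
  by case: (msupp fv) fv0 => // m0 r _; exists m0; rewrite inE eqxx.
suff -> : fv = initial_form w gv.
  exists [:: (1, initial_form w gv)]; last by rewrite big_seq1 mul1r.
  move=> a; rewrite inE => /eqP -> /=; exists gv => //.
  exact: plucker_torus_degree.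
have [m0flat m0gv] : flat m0 /\ m0 \in msupp gv.
  by apply/andP; rewrite -mfilter_supp -fvE.
have gvdeg m : m \in msupp gv -> torus_degree m = v.
  by rewrite mfilter_supp => /andP[/eqP].
rewrite fvE; apply/mpolyP => m; rewrite [LHS]mfilter_coeff [RHS]mfilter_coeff.
have [mgv|mgv] := boolP (m \in msupp gv); last first.
  by rewrite memN_msupp_eq0 // !if_same.
congr (if _ then _ else _); apply/eqP/allP => [m_flat m' m'gv|m_min].
  by rewrite -wtE ?m_flat // !gvdeg.
apply/eqP; rewrite eq_le mwt_ge0 andbT -(eqP m0flat) wtE ?m_min //.
by rewrite !gvdeg.
Qed.

Definition cell_proj (Q : cell w) :
    morphism (initial_degeneration K w) (thin_cell K (sval Q)) :=
  torus_proj_map (finset.subsetT _) (cell_thin_ideal (svalP Q)).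

Lemma cell_proj_cone (Q Q' : cell w)
    (F : is_face (matroid_polytope R (sval Q')) (matroid_polytope R (sval Q)))
    (a : coord_ring (thin_cell K (sval Q'))) :
  cell_proj Q' a = cell_proj Q (face_map K F a).
Proof. exact: torus_proj_map_comp. Qed.

End Degeneration.

(** * Ratios of coordinates and what they generate *)

Section Ratios.
Variables (K : fieldType) (I : finType).
Local Notation P := {mpoly K[#|I|]}.
Implicit Types (B : {set I}) (i j k : I).

Lemma mvarsD1 B i : i \in B -> mvars K B = mvar K i * mvars K (B :\ i).
Proof. exact: big_setD1. Qed.

Lemma mvar_homog i : mvar K i \is 1.-homog.
Proof. by rewrite dhomogX; apply/eqP; exact: mdeg1. Qed.

Section OnB.
Variable B : {set I}.

Lemma ratio_on i j : i \in B -> poly_on B (mvar K i * mvars K (B :\ j)).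
Proof.
move=> iB; rewrite poly_onM ?poly_on_var //.
by apply: poly_onS (poly_on_vars _ _); exact: finset.subsetDl.
Qed.

Lemma ratio_homog i j : j \in B ->
  mvar K i * mvars K (B :\ j) \is (1 * #|B|).-homog.
Proof.
move=> jB; rewrite mul1n (cardsD1 j) jB.
by apply: dhomogM; rewrite ?mvar_homog ?mvars_homog.
Qed.

(** The fraction p_i / p_j, over the common denominator of the localization, the
    product of all p_k with k in B. *)
Definition ratio i j (iB : i \in B) (jB : j \in B) : fraction K B :=
  Fraction (ratio_on j iB) (ratio_homog i jB).

Variable J : ideal_on K B.
Local Notation class x := (@sa_pi K (frac_setoid J) x).

Lemma fraction_eq (x y : fraction K B) :
  num x = num y -> den x = den y -> class x = class y.
Proof. by move=> en ed; apply/sa_piP/frac_eq0; rewrite en ed. Qed.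

Lemma ratio_refl i (iB : i \in B) : class (ratio iB iB) = 1.
Proof.
rewrite -sa_pi1; apply/sa_piP/frac_eq0 => /=.
by rewrite -mvarsD1 // mpolyC1 mul1r mulr1.
Qed.

Lemma ratio_trans i j k (iB : i \in B) (jB : j \in B) (kB : k \in B) :
  class (ratio iB jB) * class (ratio jB kB) = class (ratio iB kB).
Proof.
rewrite -sa_piM; apply/sa_piP/frac_eq0 => /=.
by rewrite !exprS !expr0 (mvarsD1 jB); ring.
Qed.

End OnB.

(** Both sides are p_i / p_j, before and after the change of denominator. *)
Lemma ratio_map B B' (J : ideal_on K B) (J' : ideal_on K B')
    (sB : B' \subset B) (sJ : ideal_set J' `<=` ideal_set J) i j
    (iB' : i \in B') (jB' : j \in B') (iB : i \in B) (jB : j \in B) :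
  torus_proj_map sB sJ (@sa_pi K (frac_setoid J') (ratio iB' jB')) =
  @sa_pi K (frac_setoid J) (ratio iB jB).
Proof.
rewrite torus_proj_mapE; apply: fraction_eq => //=.
rewrite expr1 -mulrA; congr (_ * _).
rewrite [RHS]/mvars (big_setID B') /=; congr (_ * _); apply: eq_bigl => k.
  rewrite !inE; case: (boolP (k \in B')) => [kB'|]; rewrite ?andbF //.
  by rewrite (fintype.subsetP sB _ kB') !andbT.
rewrite !inE; case: (eqVneq k j) => [->|_]; last by [].
by rewrite jB'.
Qed.

Section Generation.
Local Notation T := [set: I]%SET.
Variables (J : ideal_on K T).
Local Notation class x := (@sa_pi K (frac_setoid J) x).
Variable S : coord_ring (torus_proj J) -> Prop.
Hypothesis SD : forall a b, S a -> S b -> S (a + b).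
Hypothesis SM : forall a b, S a -> S b -> S (a * b).
Hypothesis S_str : forall c, S (kalg_str (coord_ring (torus_proj J)) c).
Hypothesis S_ratio : forall i j, S (class (ratio (finset.in_setT i) (finset.in_setT j))).

(** The fraction f / F^e lies in S, F being the product of all the variables.
    Fractions carry proofs of homogeneity; quantifying over them allows to
    compute with numerators and exponents alone. *)
Definition spanned (e : nat) (f : P) : Prop :=
  exists x : fraction K T, [/\ num x = f, den x = e & S (class x)].

Lemma spannedC c : spanned 0 c%:MP.
Proof. by exists (frac_str T c); split=> //; exact: S_str. Qed.

Lemma spannedD e f g : spanned e f -> spanned e g -> spanned e (f + g).
Proof.
move=> [x [<- xe Sx]] [y [<- ye Sy]].
have h : num x + num y \is (e * #|T|).-homog.
  by apply: dhomogD; [rewrite -xe|rewrite -ye]; exact: num_homog.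
exists (Fraction (poly_onD (num_on x) (num_on y)) h); split=> //.
have := SD Sx Sy; rewrite -sa_piD.
congr (S _); apply/sa_piP/frac_eq0; rewrite /= xe ye exprD; ring.
Qed.

Lemma spannedM e e' f g : spanned e f -> spanned e' g -> spanned (e + e') (f * g).
Proof.
move=> [x [<- <- Sx]] [y [<- <- Sy]]; exists (frac_mul x y); split=> //.
by have := SM Sx Sy; rewrite -sa_piM.
Qed.

Lemma spannedX e f (k : nat) : spanned e f -> spanned (k * e) (f ^+ k).
Proof.
move=> ef; elim: k => [|k IHk]; last by rewrite exprS mulSn; exact: spannedM.
by rewrite expr0 -mpolyC1; exact: spannedC.
Qed.

Lemma spanned_prod (X : finType) (e : X -> nat) (f : X -> P) :
  (forall k : X, spanned (e k) (f k)) -> spanned (\sum_k e k) (\prod_k f k).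
Proof.
move=> H; elim/big_rec2: _ => [|k g e' _ IH]; last exact: spannedM.
by rewrite -mpolyC1; exact: spannedC.
Qed.

(** Since f / F^e = g / F^e' as soon as the cross products agree. *)
Lemma spanned_equal e e' f g :
    f \is (e * #|T|).-homog -> f * mvars K T ^+ e' = g * mvars K T ^+ e ->
  spanned e' g -> spanned e f.
Proof.
move=> fe fg [x [xg xe Sx]]; exists (Fraction (poly_on_setT f) fe); split=> //.
move: Sx; congr (S _); apply/sa_piP/frac_eq0.
by rewrite /= xg xe mulrC -fg mulrC.
Qed.

Lemma prod_mvarsD1 :
  mvars K T * \prod_i mvars K (T :\ i) = mvars K T ^+ #|T|.
Proof.
rewrite [X in X * _]/mvars (eq_bigl xpredT) => [|i]; last by rewrite inE.
rewrite -big_split /= -prodr_const; apply: eq_big => [i|i _]; first by rewrite inE.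
by rewrite -mvarsD1 ?inE.
Qed.

(** With N variables and a fixed index i0, a monomial X of degree e N satisfies
      X / F^e = prod_k (p_k / p_i0)^(m k) * (prod_i (p_i0 / p_i))^e,
    because the first product is X / p_i0^(e N) and the second p_i0^(e N) / F^e.
    Without variables, X and F are both 1. *)
Lemma spanned_monomial e (m : 'X_{1..#|I|}) :
  mdeg m = (e * #|T|)%N -> spanned e ('X_[m] : P).
Proof.
move=> me; have Xhomog : ('X_[m] : P) \is (e * #|T|).-homog.
  by rewrite dhomogX; apply/eqP.
have [i0 _|I0] := pickP (@predT I); last first.
  have m0 : m = 0%MM.
    apply/eqP; rewrite -mdeg_eq0 me cardsT.
    by rewrite (eq_card0 (fun i => I0 i)) muln0.
  have T1 : mvars K T = 1 by rewrite /mvars big1 // => i; have := I0 i.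
  apply: (spanned_equal Xhomog _ (spannedC 1)).
  by rewrite T1 !expr1n m0 mpolyX0 mpolyC1.
have sp i j : spanned 1 (mvar K i * mvars K (T :\ j)).
  by exists (ratio (finset.in_setT i) (finset.in_setT j)).
apply: (spanned_equal Xhomog _ (spannedM
  (spanned_prod (fun k : 'I_#|I| => spannedX (m k) (sp (enum_val k) i0)))
  (spannedX e (spanned_prod (fun i : I => sp i0 i))))).
have -> : (\sum_(i : I) 1)%N = #|T| by rewrite sum1_card cardsT.
have -> : (\sum_(k < #|I|) m k * 1)%N = (e * #|T|)%N.
  by rewrite -me mdegE; apply: eq_bigr => k _; rewrite muln1.
have -> : \prod_(k < #|I|) (mvar K (enum_val k) * mvars K (T :\ i0)) ^+ m k =
    'X_[m] * mvars K (T :\ i0) ^+ (e * #|T|).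
  under eq_bigr => k _ do rewrite /mvar enum_valK exprMn.
  by rewrite big_split -mpolyXE_id prodrXr -mdegE me.
have -> : \prod_i (mvar K i0 * mvars K (T :\ i)) =
    mvar K i0 ^+ #|T| * \prod_i mvars K (T :\ i).
  by rewrite big_split prodr_const cardsT.
set p := mvar K i0; set r := mvars K (T :\ i0); set F := mvars K T.
have FE : F = p * r by exact: mvarsD1 (finset.in_setT i0).
have PE := prod_mvarsD1; rewrite -/F in PE.
have eT := mulnC e #|T|.
rewrite exprMn -exprM -eT.
have -> : F ^+ (e * #|T| + e * #|T|) = (p * r) ^+ (e * #|T|) * (F * \prod_i mvars K (T :\ i)) ^+ e.
  by rewrite PE -exprM -eT -FE exprD.
rewrite !exprMn; ring.
Qed.

(** A homogeneous numerator is a sum of monomials of the same degree. *)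
Lemma ratios_generate b : S b.
Proof.
elim/sa_quotW: b => x.
have [y [yx ye Sy]] : spanned (den x) (num x).
  have : forall m, m \in msupp (num x) -> mdeg m = (den x * #|T|)%N.
    by move=> m; move/dhomogP: (num_homog x) => /(_ m).
  rewrite {2}[num x]mpolyE big_seq => xdeg.
  apply: big_ind => [|f g|m mx].
  - apply: (@spanned_equal _ 0 _ 0%:MP); last exact: spannedC.
      by rewrite rpred0.
    by rewrite mpolyC0 !mul0r.
  - exact: spannedD.
  - rewrite -mul_mpolyC -[den x]add0n; apply: spannedM (spannedC _) _.
    exact: spanned_monomial (xdeg m mx).
by rewrite (fraction_eq J (esym yx) (esym ye)).
Qed.

End Generation.

End Ratios.

(** * Connecting all coordinates through edges *)

Section Surjectivity.
Variables (K : closedFieldType) (R : realType) (d n : nat).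
Variable w : subset_of d n -> R.
Local Notation index := (subset_of d n).
Local Notation class x := (@sa_pi K (frac_setoid (initial_ideal K w)) x).
Local Notation full_ratio l m :=
  (ratio K (finset.in_setT l) (finset.in_setT m)).

Variable S : coord_ring (initial_degeneration K w) -> Prop.
Hypothesis S_cell : forall (Q : cell w) a, S (cell_proj K Q a).

Lemma edge_ratio (l m : index) (x y : 'I_n) :
    x \in val l -> y \notin val l -> val m = y |: (val l :\ x) ->
  S (class (full_ratio l m)).
Proof.
move=> xl yl mE.
pose Q : cell w := exist _ (edge_matroid xl yl mE) (edge_cell xl yl mE w).
have lQ : l \in bases (sval Q) by rewrite /= !inE eqxx.
have mQ : m \in bases (sval Q) by rewrite /= !inE eqxx orbT.
rewrite -(ratio_map (finset.subsetT _) (cell_thin_ideal (svalP Q)) lQ mQ).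
exact: (S_cell (Q := Q)).
Qed.

Hypothesis S1 : S 1.
Hypothesis SM : forall a b, S a -> S b -> S (a * b).

(** Induction on the size of l minus m: exchanging an element of l outside m for
    an element of m outside l decreases it, and the ratio telescopes. *)
Lemma johnson_ratio (l m : index) : S (class (full_ratio l m)).
Proof.
have [k] := ubnP #|val l :\: val m|; elim: k l => // k IHk l.
have card_val (z : index) : #|val z| = d := eqP (valP z).
have [lm _|] := boolP (val l \subset val m).
  have -> : l = m by apply/val_inj/eqP; rewrite eqEcard lm !card_val leqnn.
  by rewrite ratio_refl.
move=> /fintype.subsetPn[x xl xm] lk.
have [y ym yl] : exists2 y, y \in val m & y \notin val l.
  apply/fintype.subsetPn; apply: contra xm => ml.
  suff -> : val m = val l by [].
  by apply/eqP; rewrite eqEcard ml !card_val leqnn.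
have l'_card : #|y |: (val l :\ x)| == d.
  rewrite cardsU1 !inE (negPf yl) andbF -[X in _ == X](card_val l).
  by rewrite [#|val l|](cardsD1 x) xl.
pose l' : index := exist _ (y |: (val l :\ x)) l'_card.
rewrite -(ratio_trans _ _ (finset.in_setT l')); apply: SM.
  exact: (@edge_ratio l l' x y).
apply: IHk; rewrite -ltnS; apply: leq_trans lk; rewrite ltnS.
apply: proper_card; apply/properP; split.
  apply/fintype.subsetP => z; rewrite !inE => /andP[zm /orP[/eqP zy|/andP[_ ->]]].
    by rewrite zy ym in zm.
  by rewrite zm.
exists x; first by rewrite !inE xm xl.
rewrite !inE eqxx /= orbF andbC; apply/negP => /andP[/eqP xy _].
by rewrite -xy xl in yl.
Qed.

End Surjectivity.

Theorem theorem1p1 (K : closedFieldType) (charK : [pchar K] =i pred0)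
    (R : realType) (d n : nat) (w : subset_of d n -> R)
    (hw : in_tropical_grassmannian K w) :
  exists psi : morphism (initial_degeneration K w) (limit (cell_diagram K w)),
    closed_immersion psi.
Proof.
have [psi [psiE _]] := @limit_universal K (cell_diagram K w)
  (initial_degeneration K w) (@cell_proj K R d n w) (@cell_proj_cone K R d n w).
exists psi => b.
pose S (b : coord_ring (initial_degeneration K w)) := exists a, psi a = b.
have S_str c : S (kalg_str (coord_ring (initial_degeneration K w)) c).
  by exists (kalg_str _ c); exact: kalg_fun_str.
have SM a1 a2 : S a1 -> S a2 -> S (a1 * a2).
  by move=> [b1 <-] [b2 <-]; exists (b1 * b2); rewrite rmorphM.
apply: (@ratios_generate _ _ (initial_ideal K w) S) => // [a1 a2|i j].
  by move=> [b1 <-] [b2 <-]; exists (b1 + b2); rewrite rmorphD.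
apply: johnson_ratio => // [Q a|].
  by exists (@limit_proj K (cell_diagram K w) Q a); exact: psiE.
by rewrite -(rmorph1 (kalg_str (coord_ring (initial_degeneration K w)))).
Qed.
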